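(* Let $k$ be a field of characteristic two, let $G=\mathrm{SL}_2$ over $k$, let $T\subset G$ be the diagonal torus and let $N$ be the normalizer of $T$ in $G$. For every $r\ge 1$, let $G_r$ be the $r$-th Frobenius kernel of $G$. Then $H^i(G_r,k[G/N])=0$ for all $i>0$ and all $r\ge1$.
   Context: $G=\mathrm{SL}_2$ is regarded as an affine algebraic group scheme over $k$, with $k[G]=k[a,b,c,d]/(ad-bc-1)$. The diagonal subgroup is $T$, and $N=T\cup\sigma T$ with $\sigma=\begin{pmatrix}0&1\\1&0\end{pmatrix}$ (which has determinant $-1=1$ in characteristic two). $k[G/N]$ is the ring of regular functions on $G$ invariant under right translation by $N$, viewed as a rational $G$-module through left translation, i.e. $(g\cdot f)(x)=f(g^{-1}x)$, and by restriction as a $G_r$-module. The $r$-th Frobenius kernel $G_r$ is the (infinitesimal, scheme-theoretic) kernel of the $r$-th iterate of the Frobenius homomorphism $G\to G$ which raises matrix entries to the $2^r$-th power. $H^i(G_r,M)$ denotes rational cohomology, i.e. the $i$-th right derived functor of $M\mapsto M^{G_r}$ on rational $G_r$-modules. *)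

(* Defs.v *)
From HB Require Import structures.
From mathcomp Require Import all_boot all_order all_algebra.
From mathcomp Require Import boolp classical_sets.
From mathcomp Require Import mpoly.

Set Implicit Arguments.
Unset Strict Implicit.
Unset Printing Implicit Defensive.

Import GRing.Theory.
Local Open Scope ring_scope.
Local Open Scope quotient_scope.

Reserved Notation "U \ox V" (at level 40, left associativity).
Reserved Notation "u *t v" (at level 40, left associativity).

(* U \ox V is the set of formal sums of pairs modulo the relations holding    *)
(* under every bilinear map, so that its universal property holds by          *)
(* construction (tliftE, tensor_ind).                                         *)
Section Tensor.
Variable k : fieldType.

Definition bilin (U V W : lmodType k) (b : U -> V -> W) : Prop :=
  (forall v, linear (b^~ v)) /\ (forall u, linear (b u)).

Section Def.
Variables U V : lmodType k.

Definition tsum (W : lmodType k) (b : U -> V -> W) (s : seq (U * V)) : W :=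
  \sum_(p <- s) b p.1 p.2.

Definition tensor_rel (s t : seq (U * V)) : bool :=
  `[< forall (W : lmodType k) (b : U -> V -> W), bilin b -> tsum b s = tsum b t >].

Lemma tensor_rel_equiv : equiv_class_of tensor_rel.
Proof.
split=> [s|s t|t s u].
- exact/asboolP.
- by apply/asboolP/asboolP => h W b /h ->.
- by move=> /asboolP h1 /asboolP h2; apply/asboolP => W b hb; rewrite h1 ?h2.
Qed.

Canonical tensor_equiv := EquivRelPack tensor_rel_equiv.
Canonical tensor_encModRel := defaultEncModRel tensor_rel.

Definition tensor := {eq_quot tensor_rel}.
HB.instance Definition _ := Choice.on tensor.
HB.instance Definition _ : EqQuotient _ tensor_rel tensor := EqQuotient.on tensor.

Definition tclass (s : seq (U * V)) : tensor := \pi_tensor s.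

Definition pure (u : U) (v : V) : tensor := tclass [:: (u, v)].

Definition tlift (W : lmodType k) (b : U -> V -> W) (x : tensor) : W :=
  tsum b (repr x).

Lemma tlift_class (W : lmodType k) (b : U -> V -> W) s : bilin b -> tlift b (tclass s) = tsum b s.
Proof.
move=> hb; rewrite /tlift /tclass; case: piP => t /eqmodP /= /asboolP h.
by rewrite h.
Qed.

Lemma tensor_eqP (x y : tensor) :
  (forall (W : lmodType k) (b : U -> V -> W), bilin b -> tlift b x = tlift b y) ->
  x = y.
Proof.
by rewrite -[x]reprK -[y]reprK => h; apply/eqmodP/asboolP => W b hb;
   have := h W b hb; rewrite !tlift_class.
Qed.

Definition tzero : tensor := tclass [::].
Definition tadd (x y : tensor) : tensor := tclass (repr x ++ repr y).
Definition tscal (a : k) (x : tensor) : tensor :=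
  tclass [seq (a *: p.1, p.2) | p <- repr x].
Definition topp (x : tensor) : tensor := tscal (-1) x.

Lemma tlift0_ (W : lmodType k) (b : U -> V -> W) : bilin b -> tlift b tzero = 0.
Proof. by move=> hb; rewrite tlift_class // /tsum big_nil. Qed.

Lemma tliftD_ (W : lmodType k) (b : U -> V -> W) x y :
  bilin b -> tlift b (tadd x y) = tlift b x + tlift b y.
Proof. by move=> hb; rewrite tlift_class // /tsum big_cat. Qed.

Lemma bilinZl (W : lmodType k) (b : U -> V -> W) a u v :
  bilin b -> b (a *: u) v = a *: b u v.
Proof.
move=> [h _]; have := h v a u 0; have := h v (-1) 0 0.
by rewrite !addr0 scaler0 scaleN1r addNr => ->; rewrite addr0.
Qed.

Lemma tliftZ_ (W : lmodType k) (b : U -> V -> W) a x :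
  bilin b -> tlift b (tscal a x) = a *: tlift b x.
Proof.
move=> hb; rewrite tlift_class // /tlift /tsum big_map scaler_sumr.
by apply: eq_bigr => p _; rewrite /= bilinZl.
Qed.

Let taddA : associative tadd.
Proof. by move=> x y z; apply: tensor_eqP => W b hb; rewrite !tliftD_ // addrA. Qed.
Let taddC : commutative tadd.
Proof. by move=> x y; apply: tensor_eqP => W b hb; rewrite !tliftD_ // addrC. Qed.
Let tadd0 : left_id tzero tadd.
Proof. by move=> x; apply: tensor_eqP => W b hb; rewrite tliftD_ // tlift0_ // add0r. Qed.
Let taddN : left_inverse tzero topp tadd.
Proof.
move=> x; apply: tensor_eqP => W b hb.
by rewrite tliftD_ // tlift0_ // tliftZ_ // scaleN1r addNr.
Qed.

HB.instance Definition _ := GRing.isZmodule.Build tensor taddA taddC tadd0 taddN.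

Let tscalA a b x : tscal a (tscal b x) = tscal (a * b) x.
Proof. by apply: tensor_eqP => W c hc; rewrite !tliftZ_ // scalerA. Qed.
Let tscal1 : left_id 1 tscal.
Proof. by move=> x; apply: tensor_eqP => W c hc; rewrite !tliftZ_ // scale1r. Qed.
Let tscalDr : right_distributive tscal +%R.
Proof.
by move=> a x y; apply: tensor_eqP => W c hc;
   rewrite !(tliftZ_, tliftD_) // scalerDr.
Qed.
Let tscalDl x : {morph tscal^~ x : a b / a + b}.
Proof.
by move=> a b; apply: tensor_eqP => W c hc;
   rewrite !(tliftZ_, tliftD_) // scalerDl.
Qed.

HB.instance Definition _ :=
  GRing.Zmodule_isLmodule.Build k tensor tscalA tscal1 tscalDr tscalDl.

Lemma tlift_linear (W : lmodType k) (b : U -> V -> W) : bilin b -> linear (tlift b).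
Proof.
move=> hb a x y; rewrite -[LHS]/(tlift b (tadd (tscal a x) y)).
by rewrite tliftD_ // tliftZ_.
Qed.

Lemma tliftE (W : lmodType k) (b : U -> V -> W) u v : bilin b -> tlift b (pure u v) = b u v.
Proof. by move=> hb; rewrite tlift_class // /tsum big_seq1. Qed.

Lemma pure_bilin : bilin pure.
Proof.
split=> [v|u] a x y; apply: tensor_eqP => W b hb;
  rewrite (tlift_linear hb) !tliftE //; case: hb => hl hr; [exact: hl|exact: hr].
Qed.

Lemma tclassE s : tclass s = \sum_(p <- s) pure p.1 p.2.
Proof.
apply: tensor_eqP => W b hb; rewrite tlift_class //.
elim: s => [|p s IH]; rewrite /tsum.
  by rewrite !big_nil -[in RHS]/tzero tlift0_.
rewrite !big_cons -[pure _ _]scale1r (tlift_linear hb) scale1r tliftE //.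
by rewrite -IH.
Qed.

Lemma tensor_ind (P : tensor -> Prop) :
  (forall u v, P (pure u v)) -> (forall x y, P x -> P y -> P (x + y)) ->
  forall x, P x.
Proof.
move=> hp hD x; rewrite -[x]reprK -/(tclass _) tclassE.
elim: (repr x) => [|p s IH]; last by rewrite big_cons; apply: hD.
have -> : \sum_(p <- [::]) pure p.1 p.2 = pure 0 0; last exact: hp.
rewrite big_nil; apply/esym.
by rewrite -{1}[(0 : U)](scale0r 0) (bilinZl _ _ _ pure_bilin) scale0r.
Qed.

End Def.
End Tensor.

Section LinearExtension.
Variable k : fieldType.

Definition lin_graph (V W : lmodType k) (G : set (V * W)) : Prop :=
  [/\ G (0, 0), (forall a p q, G p -> G q -> G (a *: p + q))
    & (forall w, G (0, w) -> w = 0)].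

Lemma lin_extend (V W : lmodType k) (G0 : set (V * W)) : lin_graph G0 ->
  exists f : {linear V -> W}, forall p, G0 p -> f p.1 = p.2.
Proof.
move=> lG0; pose P G := (exists p, G p) -> lin_graph G /\ (G0 `<=` G)%classic.
have [|G [PG maxG]] := @Zorn_bigcup (V * W)%type P.
  move=> F FP Ftot [p [X FX Xp]].
  have good Y q : F Y -> Y q -> lin_graph Y /\ (G0 `<=` Y)%classic.
    by move=> FY Yq; apply: (FP _ FY); exists q.
  have [lX sX] := good _ _ FX Xp; split; last by move=> q /sX Xq; exists X.
  split=> [|a q q' [Y FY Yq] [Y' FY' Yq']|w [Y FY Yw]].
  - by exists X => //; case: lX.
  - have [[_ hY _] _] := good _ _ FY Yq; have [[_ hY' _] _] := good _ _ FY' Yq'.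
    case: (Ftot _ _ FY FY') => sYY'.
      by exists Y' => //; apply: hY' => //; apply: sYY'.
    by exists Y => //; apply: hY => //; apply: sYY'.
  - by have [[_ _ h] _] := good _ _ FY Yw; apply: h.
have [p Gp] : exists p, G p.
  apply: contrapT => nG; apply: (maxG G0); last by move=> _; split.
  split; first by move=> q Gq; case: nG; exists q.
  by move=> sG; apply: nG; exists (0, 0); apply: sG; case: lG0.
have [[G00 Glin Gsv] sG] : lin_graph G /\ (G0 `<=` G)%classic by apply: PG; exists p.
have Gtot v : exists w, G (v, w).
  apply: contrapT => nv.
  pose G1 : set (V * W) :=
    fun q => exists c, exists r, G r /\ q = c *: (v, 0) + r.
  have sG1 : (G `<=` G1)%classic by move=> q Gq; exists 0, q; rewrite scale0r add0r.
  apply: (maxG G1).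
    split=> // sG1'; apply: nv; exists 0; apply: sG1'.
    by exists 1, (0, 0); split=> //; rewrite scale1r addr0.
  move=> _; split; last by move=> q /sG /sG1.
  split=> [|a q q' [c [r [Gr ->]]] [c' [r' [Gr' ->]]]|w [c [r [Gr]]]].
  - exact: sG1.
  - exists (a * c + c'), (a *: r + r'); split; first exact: Glin.
    by rewrite scalerDr scalerA scalerDl addrACA.
  - case: r Gr => r1 r2 Gr [e1 e2]; move: e1 e2.
    rewrite scaler0 add0r => e1 ->.
    have [c0|cn0] := eqVneq c 0.
      by apply: Gsv; move: e1 Gr; rewrite c0 scale0r add0r => <-.
    case: nv; exists (- c^-1 *: r2).
    have := Glin (- c^-1) _ _ Gr G00; rewrite addr0.
    have -> : - c^-1 *: (r1, r2) = (v, - c^-1 *: r2); last by [].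
    congr (_, _); move/eqP: e1; rewrite eq_sym addrC addr_eq0 => /eqP ->.
    by rewrite scaleNr scalerN opprK scalerA mulVf // scale1r.
have Gfun v w w' : G (v, w) -> G (v, w') -> w = w'.
  move=> h h'; apply/eqP; rewrite -subr_eq0; apply/eqP/Gsv.
  have := Glin (-1) _ _ h' h; rewrite scaleN1r.
  by have -> : - (v, w') + (v, w) = (0, w - w') by congr (_, _); rewrite ?addNr // addrC.
have [f hf] := choice Gtot.
have f_lin : linear f.
  by move=> a x y; apply: Gfun (hf _) (Glin a _ _ (hf x) (hf y)).
pose fL : {linear V -> W} := HB.pack f (GRing.isLinear.Build k V W *:%R f f_lin).
exists fL => -[v w] /sG Gvw /=; exact: Gfun (hf v) Gvw.
Qed.

Lemma lin_functional (V : lmodType k) (S : set V) (v : V) :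
  S 0 -> (forall a x y, S x -> S y -> S (a *: x + y)) -> ~ S v ->
  exists l : {linear V -> k^o}, l v = 1 /\ forall x, S x -> l x = 0.
Proof.
move=> S0 Slin nSv.
pose G : set (V * k^o) := fun p => exists2 x, S x & p.1 = p.2 *: v + x.
have [|f hf] := @lin_extend V k^o G.
  split=> [|a [p1 p2] [q1 q2] [x Sx /= e] [y Sy /= e']|w [x Sx /= e]].
  - by exists 0 => //=; rewrite scale0r addr0.
  - exists (a *: x + y) => /=; first exact: Slin.
    by rewrite e e' scalerDr scalerA scalerDl addrACA.
  - apply/eqP; apply: contra_notT nSv => w0.
    have -> : v = (- w^-1) *: x + 0; last exact: Slin.
    move/eqP: e; rewrite eq_sym addrC addr_eq0 => /eqP ->.
    by rewrite addr0 scaleNr scalerN opprK scalerA mulVf // scale1r.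
exists f; split=> [|x Sx].
  by apply: (hf (v, 1)); exists 0 => //=; rewrite scale1r addr0.
by apply: (hf (x, 0)); exists x => //=; rewrite scale0r add0r.
Qed.

Lemma lin_linv (W V : lmodType k) (j : {linear W -> V}) :
  injective j -> exists p : {linear V -> W}, cancel j p.
Proof.
move=> j_inj; pose G : set (V * W) := fun p => p.1 = j p.2.
have [|f hf] := @lin_extend V W G; last by exists f => w; apply: (hf (j w, w)).
rewrite /G; split=> /= [|a p q -> ->|w].
- by rewrite linear0.
- by rewrite linearP.
- by move=> e; apply: j_inj; rewrite -e linear0.
Qed.
End LinearExtension.

Arguments bilin {k U V W} b.
Arguments tlift {k U V W} b x.
Arguments pure {k U V} u v.
Notation "U \ox V" := (tensor U V) : type_scope.
Notation "u *t v" := (pure u v) : ring_scope.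

Section TensorTheory.
Variable k : fieldType.
Implicit Types U V W : lmodType k.

Lemma tliftD U V W (b : U -> V -> W) : bilin b -> {morph tlift b : x y / x + y}.
Proof. by move=> hb x y; have := tlift_linear hb 1 x y; rewrite !scale1r. Qed.

Lemma tlift0 U V W (b : U -> V -> W) : bilin b -> tlift b 0 = 0.
Proof. by move=> hb; apply: (addrI (tlift b 0)); rewrite -tliftD // !addr0. Qed.

Lemma tliftZ U V W (b : U -> V -> W) a x :
  bilin b -> tlift b (a *: x) = a *: tlift b x.
Proof. by move=> hb; have := tlift_linear hb a x 0; rewrite tlift0 // !addr0. Qed.

Lemma pureDl U V (u u' : U) (v : V) : (u + u') *t v = u *t v + u' *t v.
Proof. by have := (pure_bilin U V).1 v 1 u u'; rewrite !scale1r. Qed.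
Lemma pureDr U V (u : U) (v v' : V) : u *t (v + v') = u *t v + u *t v'.
Proof. by have := (pure_bilin U V).2 u 1 v v'; rewrite !scale1r. Qed.
Lemma pure0l U V (v : V) : (0 : U) *t v = 0.
Proof. by apply: (addrI (0 *t v)); rewrite -pureDl !addr0. Qed.
Lemma pure0r U V (u : U) : u *t (0 : V) = 0.
Proof. by apply: (addrI (u *t 0)); rewrite -pureDr !addr0. Qed.
Lemma pureZl U V a (u : U) (v : V) : (a *: u) *t v = a *: (u *t v).
Proof. by have := (pure_bilin U V).1 v a u 0; rewrite pure0l !addr0. Qed.
Lemma pureZr U V a (u : U) (v : V) : u *t (a *: v) = a *: (u *t v).
Proof. by have := (pure_bilin U V).2 u a v 0; rewrite pure0r !addr0. Qed.

Lemma tensor_ext U V (W : zmodType) (f g : U \ox V -> W) :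
  {morph f : x y / x + y} -> {morph g : x y / x + y} ->
  (forall u v, f (u *t v) = g (u *t v)) -> f =1 g.
Proof.
by move=> hf hg h x; elim/tensor_ind: x => // x y hx hy; rewrite hf hg hx hy.
Qed.

Section Map.
Variables (U V U' V' : lmodType k) (f : {linear U -> U'}) (g : {linear V -> V'}).

Definition tmap : U \ox V -> U' \ox V' := tlift (fun u v => f u *t g v).

Lemma tmap_bilin : bilin (fun u v => f u *t g v).
Proof.
by split=> [v|u] a x y; rewrite linearP (pureDl, pureDr) (pureZl, pureZr).
Qed.

HB.instance Definition _ :=
  GRing.isLinear.Build k (U \ox V) (U' \ox V') *:%R tmap (tlift_linear tmap_bilin).

Lemma tmapE u v : tmap (u *t v) = f u *t g v.
Proof. by rewrite /tmap tliftE //; exact: tmap_bilin. Qed.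
Lemma tmapD : {morph tmap : x y / x + y}. Proof. exact: linearD. Qed.
End Map.

(* multiplication by a in the A-module V \ox A *)
Definition ascale V (A : comAlgType k) (a : A) : V \ox A -> V \ox A :=
  tlift (fun v b => v *t (a * b)).

Lemma ascale_bilin V (A : comAlgType k) (a : A) :
  bilin (fun (v : V) (b : A) => v *t (a * b)).
Proof.
split=> [b|v] c x y; first by rewrite pureDl pureZl.
by rewrite mulrDr -scalerAr pureDr pureZr.
Qed.

Lemma ascaleE V (A : comAlgType k) (a : A) (v : V) b :
  ascale a (v *t b) = v *t (a * b).
Proof. by rewrite /ascale tliftE //; exact: ascale_bilin. Qed.

Definition tcontract V (A : lmodType k) (l : {linear A -> k^o}) : V \ox A -> V :=
  tlift (fun v a => l a *: v).

Lemma tcontract_bilin V (A : lmodType k) (l : {linear A -> k^o}) :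
  bilin (fun (v : V) (a : A) => l a *: v).
Proof.
split=> [b|a] c x y; first by rewrite scalerDr !scalerA mulrC.
by rewrite linearP scalerDl -scalerA.
Qed.

Lemma tcontractE V (A : lmodType k) (l : {linear A -> k^o}) (v : V) a :
  tcontract l (v *t a) = l a *: v.
Proof. by rewrite /tcontract tliftE //; exact: tcontract_bilin. Qed.

Lemma tcontractD V (A : lmodType k) (l : {linear A -> k^o}) :
  {morph @tcontract V A l : x y / x + y}.
Proof. exact/tliftD/tcontract_bilin. Qed.

Lemma tensor_sum V (A : lmodType k) (x : V \ox A) :
  exists n (v : 'I_n -> V) (a : 'I_n -> A), x = \sum_i v i *t a i.
Proof.
elim/tensor_ind: x => [v a|x y [n [v [a ->]]] [m [w [b ->]]]].
  by exists 1%N, (fun=> v), (fun=> a); rewrite big_ord1.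
exists (n + m)%N, (fun i => match split i with inl i => v i | inr i => w i end),
  (fun i => match split i with inl i => a i | inr i => b i end).
rewrite big_split_ord /=; congr (_ + _); apply: eq_bigr => i _.
  by rewrite (unsplitK (inl i)).
by rewrite (unsplitK (inr i)).
Qed.

Lemma tensor_sep V (A : lmodType k) (x : V \ox A) :
  (forall l : {linear A -> k^o}, tcontract l x = 0) -> x = 0.
Proof.
have [n [v [a ->]]] := tensor_sum x => h.
have {}h (l : {linear A -> k^o}) : \sum_i l (a i) *: v i = 0.
  rewrite -[RHS](h l) (big_morph _ (tcontractD l) (tlift0 (tcontract_bilin V l))).
  by apply: eq_bigr => i _; rewrite tcontractE.
elim: n v a h => [|n IH] v a h; first by rewrite big_ord0.
pose S : set A := fun y => exists c : 'I_n -> k, y = \sum_i c i *: a (lift ord0 i).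
rewrite big_ord_recl; have [[c hc]|nS] := pselect (S (a ord0)).
  have -> : v ord0 *t a ord0 = \sum_i (c i *: v ord0) *t a (lift ord0 i).
    rewrite hc (big_morph _ (pureDr (v ord0)) (pure0r _ (v ord0))).
    by apply: eq_bigr => i _; rewrite pureZr pureZl.
  rewrite -big_split /= -[RHS](IH (fun i => c i *: v ord0 + v (lift ord0 i))
    (fun i => a (lift ord0 i))) => [|l].
    by apply: eq_bigr => i _; rewrite pureDl.
  rewrite -[RHS](h l) big_ord_recl hc linear_sum scaler_suml -big_split /=.
  by apply: eq_bigr => i _; rewrite linearZ /= scalerDr scalerA mulrC.
have [||l [l1 l0]] := lin_functional _ _ nS.
- by exists (fun=> 0); rewrite big1 // => i _; rewrite scale0r.
- move=> d _ _ [c ->] [c' ->]; exists (fun i => d * c i + c' i).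
  rewrite scaler_sumr -big_split /=; apply: eq_bigr => i _.
  by rewrite scalerA scalerDl.
have la i : l (a (lift ord0 i)) = 0.
  apply: l0; exists (fun j => (j == i)%:R).
  rewrite (bigD1 i) //= eqxx scale1r big1 ?addr0 // => j /negbTE ->.
  by rewrite scale0r.
have v0 : v ord0 = 0.
  have := h l; rewrite big_ord_recl l1 scale1r big1 ?addr0 // => i _.
  by rewrite la scale0r.
rewrite v0 pure0l add0r; apply: IH => l'.
by have := h l'; rewrite big_ord_recl v0 scaler0 add0r.
Qed.
End TensorTheory.

Section TensorAlgebra.
Variables (k : fieldType) (A B : comAlgType k).

Definition tmul (x y : A \ox B) : A \ox B :=
  tlift (fun a b => tlift (fun a' b' => (a * a') *t (b * b')) y) x.

Let in_bilin (a : A) (b : B) : bilin (fun a' b' => (a * a') *t (b * b')).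
Proof.
split=> [b'|a'] c x y.
  by rewrite mulrDr -scalerAr pureDl pureZl.
by rewrite mulrDr -scalerAr pureDr pureZr.
Qed.

Let out_bilin (y : A \ox B) :
  bilin (fun a b => tlift (fun a' b' => (a * a') *t (b * b')) y).
Proof.
split=> [b|a] c x z; elim/tensor_ind: y => [u v|y1 y2 h1 h2].
- by rewrite !tliftE // mulrDl -scalerAl pureDl pureZl.
- by rewrite !tliftD // h1 h2 scalerDr addrACA.
- by rewrite !tliftE // mulrDl -scalerAl pureDr pureZr.
- by rewrite !tliftD // h1 h2 scalerDr addrACA.
Qed.

Lemma tmulE a b a' b' : tmul (a *t b) (a' *t b') = (a * a') *t (b * b').
Proof. by rewrite /tmul !tliftE. Qed.

Let tmulDl : left_distributive tmul +%R.
Proof. by move=> x y z; rewrite /tmul tliftD. Qed.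
Let tmulDr : right_distributive tmul +%R.
Proof.
move=> x y z; elim/tensor_ind: x => [u v|x x' h h'].
  by rewrite /tmul !tliftE // tliftD.
by rewrite !tmulDl h h' addrACA.
Qed.
Let tmulC : commutative tmul.
Proof.
move=> x y; elim/tensor_ind: x => [u v|x x' h h']; last by rewrite tmulDl tmulDr h h'.
elim/tensor_ind: y => [u' v'|y y' h h']; last by rewrite tmulDl tmulDr h h'.
by rewrite !tmulE mulrC [v * _]mulrC.
Qed.
Let tmulA : associative tmul.
Proof.
move=> x y z; elim/tensor_ind: x => [u v|x x' h h']; last by rewrite !tmulDl h h'.
elim/tensor_ind: y => [u' v'|y y' h h']; last by rewrite !(tmulDl, tmulDr) h h'.
elim/tensor_ind: z => [u'' v''|z z' h h']; last by rewrite !tmulDr h h'.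
by rewrite !tmulE !mulrA.
Qed.
Let tmul1 : left_id (1 *t 1) tmul.
Proof.
move=> x; elim/tensor_ind: x => [u v|x x' h h']; last by rewrite tmulDr h h'.
by rewrite tmulE !mul1r.
Qed.
Let tmul_nz : (1 : A) *t (1 : B) != 0.
Proof.
have [||/eqP|l [l1 _]] := @lin_functional k B (fun b => b = 0) 1.
- by [].
- by move=> a x y -> ->; rewrite scaler0 addr0.
- by rewrite oner_eq0.
have hb : bilin (fun (a : A) (b : B) => l b *: a).
  split=> [b|a] c x y; first by rewrite scalerDr !scalerA mulrC.
  by rewrite linearP scalerDl -scalerA.
apply/eqP => /(congr1 (tlift (fun (a : A) (b : B) => l b *: a))).
by rewrite tliftE // tlift0 // l1 scale1r; apply/eqP; rewrite oner_eq0.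
Qed.

HB.instance Definition _ := GRing.Zmodule_isComNzRing.Build (A \ox B)
  tmulA tmulC tmul1 tmulDl tmul_nz.

Let tscaleAl a (x y : A \ox B) : a *: (x * y) = (a *: x) * y.
Proof. by rewrite -[RHS]/(tmul _ _) /tmul tliftZ. Qed.

HB.instance Definition _ := GRing.Lmodule_isLalgebra.Build k (A \ox B) tscaleAl.
HB.instance Definition _ := GRing.Lalgebra_isComAlgebra.Build k (A \ox B).

Definition tinl (a : A) : A \ox B := a *t 1.
Definition tinr (b : B) : A \ox B := 1 *t b.

Lemma tinl_linear : linear tinl.
Proof. by move=> c x y; rewrite /tinl pureDl pureZl. Qed.
Lemma tinr_linear : linear tinr.
Proof. by move=> c x y; rewrite /tinr pureDr pureZr. Qed.
HB.instance Definition _ := GRing.isLinear.Build k A (A \ox B) *:%R tinl tinl_linear.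
HB.instance Definition _ := GRing.isLinear.Build k B (A \ox B) *:%R tinr tinr_linear.

Lemma pureM a b a' b' : (a *t b) * (a' *t b') = (a * a') *t (b * b') :> A \ox B.
Proof. exact: tmulE. Qed.

Lemma tinl_monoid : GRing.monoid_morphism tinl.
Proof. by split=> // x y; rewrite /tinl pureM mul1r. Qed.
Lemma tinr_monoid : GRing.monoid_morphism tinr.
Proof. by split=> // x y; rewrite /tinr pureM mul1r. Qed.
HB.instance Definition _ := GRing.isMonoidMorphism.Build A (A \ox B) tinl tinl_monoid.
HB.instance Definition _ := GRing.isMonoidMorphism.Build B (A \ox B) tinr tinr_monoid.
End TensorAlgebra.

Section TensorAlgebraMap.
Variables (k : fieldType) (A B A' B' : comAlgType k).
Variables (f : {lrmorphism A -> A'}) (g : {lrmorphism B -> B'}).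

Lemma tmap_monoid : GRing.monoid_morphism (tmap f g).
Proof.
split=> [|x y]; first by rewrite -[1]/(1 *t 1) tmapE !rmorph1.
elim/tensor_ind: x => [u v|x x' h h']; last by rewrite mulrDl !tmapD h h' mulrDl.
elim/tensor_ind: y => [u' v'|y y' h h']; last by rewrite mulrDr !tmapD h h' mulrDr.
by rewrite pureM !tmapE pureM !rmorphM.
Qed.
HB.instance Definition _ :=
  GRing.isMonoidMorphism.Build (A \ox B) (A' \ox B') (tmap f g) tmap_monoid.
End TensorAlgebraMap.

(* k[SL_2] = k[a,b,c,d]/(ad - bc - 1); the variable in position (i, j) of the *)
(* generic matrix is indexed by mxvec_index i j.                              *)
Section CoordinateRing.
Variable k : fieldType.

Definition gen_mx : 'M[{mpoly k[2 * 2]}]_2 :=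
  \matrix_(i, j) 'X_(mxvec_index i j).

Definition mx_eval (A : comAlgType k) (x : 'M[A]_2) (p : {mpoly k[2 * 2]}) : A :=
  mmap (GRing.in_alg A) (mxvec x 0) p.

Section Eval.
Variables (A : comAlgType k) (x : 'M[A]_2).

Lemma mx_eval_linear : linear (mx_eval x).
Proof. by move=> c p q; rewrite /mx_eval raddfD /= mmapZ mulr_algl. Qed.
HB.instance Definition _ :=
  GRing.isLinear.Build k {mpoly k[2 * 2]} A *:%R (mx_eval x) mx_eval_linear.

Lemma mx_eval_monoid : GRing.monoid_morphism (mx_eval x).
Proof. by split=> [|p q]; rewrite /mx_eval ?rmorph1 ?rmorphM. Qed.
HB.instance Definition _ :=
  GRing.isMonoidMorphism.Build {mpoly k[2 * 2]} A (mx_eval x) mx_eval_monoid.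

Lemma mx_eval_gen : map_mx (mx_eval x) gen_mx = x.
Proof.
by apply/matrixP => i j; rewrite !mxE /mx_eval mmapX mmap1U mxvecE.
Qed.

Lemma mx_eval_det : mx_eval x (\det gen_mx - 1) = \det x - 1.
Proof. by rewrite rmorphB rmorph1 -det_map_mx mx_eval_gen. Qed.
End Eval.

Lemma mx_eval_uniq (A : comAlgType k) (f : {lrmorphism {mpoly k[2 * 2]} -> A}) p :
  f p = mx_eval (map_mx f gen_mx) p.
Proof.
rewrite {1}[p]mpolyE linear_sum /mx_eval /mmap; apply: eq_bigr => m _.
rewrite linearZ /= mulr_algl; congr (_ *: _).
rewrite mpolyXE_id rmorph_prod /=; apply: eq_bigr => i _; rewrite rmorphXn /=.
by case/mxvec_indexP: i => i j; rewrite mxvecE !mxE.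
Qed.

Definition sl2_ideal : {pred {mpoly k[2 * 2]}} :=
  fun p => `[< exists q, p = q * (\det gen_mx - 1) >].

Lemma sl2_idealr : idealr_closed sl2_ideal.
Proof.
split.
- by apply/asboolP; exists 0; rewrite mul0r.
- apply/asboolP => -[q /(congr1 (mx_eval (1%:M : 'M[k^o]_2)))].
  rewrite rmorph1 rmorphM /= mx_eval_det det1 subrr mulr0.
  by apply/eqP; rewrite oner_eq0.
- move=> a _ _ /asboolP[q ->] /asboolP[q' ->]; apply/asboolP.
  by exists (a * q + q'); rewrite mulrDl mulrA.
Qed.
HB.instance Definition _ := isIdealr.Build {mpoly k[2 * 2]} sl2_ideal sl2_idealr.

Definition kSL2 := {ideal_quot sl2_ideal}.
HB.instance Definition _ := GRing.ComNzRing.on kSL2.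

Definition kclass (p : {mpoly k[2 * 2]}) : kSL2 := \pi_kSL2 p.

Lemma kclass_additive : additive kclass.
Proof. by move=> p q; rewrite /kclass !piE. Qed.
HB.instance Definition _ :=
  GRing.isAdditive.Build {mpoly k[2 * 2]} kSL2 kclass kclass_additive.
Lemma kclass_monoid : GRing.monoid_morphism kclass.
Proof. by split=> [|p q]; rewrite /kclass !piE. Qed.
HB.instance Definition _ :=
  GRing.isMonoidMorphism.Build {mpoly k[2 * 2]} kSL2 kclass kclass_monoid.

Definition kscale (c : k) (f : kSL2) : kSL2 := kclass c%:MP * f.
Let kscaleA a b f : kscale a (kscale b f) = kscale (a * b) f.
Proof. by rewrite /kscale mulrA -rmorphM mpolyCM. Qed.
Let kscale1 : left_id 1 kscale.
Proof. by move=> f; rewrite /kscale rmorph1 mul1r. Qed.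
Let kscaleDr : right_distributive kscale +%R.
Proof. by move=> a f g; rewrite /kscale mulrDr. Qed.
Let kscaleDl f : {morph kscale^~ f : a b / a + b}.
Proof. by move=> a b; rewrite /kscale mpolyCD rmorphD mulrDl. Qed.
HB.instance Definition _ :=
  GRing.Zmodule_isLmodule.Build k kSL2 kscaleA kscale1 kscaleDr kscaleDl.
Let kscaleAl a (f g : kSL2) : a *: (f * g) = (a *: f) * g.
Proof. exact: mulrA. Qed.
HB.instance Definition _ := GRing.Lmodule_isLalgebra.Build k kSL2 kscaleAl.
HB.instance Definition _ := GRing.Lalgebra_isComAlgebra.Build k kSL2.

Lemma kclass_scalable : scalable kclass.
Proof. by move=> c p; rewrite -mul_mpolyC rmorphM. Qed.
HB.instance Definition _ :=
  GRing.isScalable.Build k {mpoly k[2 * 2]} kSL2 *:%R kclass kclass_scalable.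

(* the value of a regular function at a point x of SL_2(A); it does not       *)
(* depend on the representative when \det x = 1 (evE)                         *)
Definition ev (A : comAlgType k) (x : 'M[A]_2) (f : kSL2) : A := mx_eval x (repr f).

Lemma evE (A : comAlgType k) (x : 'M[A]_2) p :
  \det x = 1 -> ev x (kclass p) = mx_eval x p.
Proof.
move=> hx; apply/eqP; rewrite -subr_eq0 -rmorphB /=.
have : kclass (repr (kclass p)) = kclass p by exact: reprK.
move/eqP; rewrite -Quotient.idealrBE => /asboolP[q ->].
by rewrite rmorphM /= mx_eval_det hx subrr mulr0.
Qed.

Lemma kSL2P (f : kSL2) : exists p, f = kclass p.
Proof. by exists (repr f); rewrite [RHS]reprK. Qed.

Section EvMorphism.
Variables (A : comAlgType k) (x : 'M[A]_2) (hx : \det x = 1).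

Definition ev_at of \det x = 1 := ev x.

Lemma ev_linear : linear (ev_at hx).
Proof.
move=> c f g; have [p ->] := kSL2P f; have [q ->] := kSL2P g.
by rewrite -linearP /ev_at !evE // linearP.
Qed.
HB.instance Definition _ := GRing.isLinear.Build k kSL2 A *:%R (ev_at hx) ev_linear.
Lemma ev_monoid : GRing.monoid_morphism (ev_at hx).
Proof.
split=> [|f g]; first by rewrite -(rmorph1 kclass) /ev_at evE // rmorph1.
have [p ->] := kSL2P f; have [q ->] := kSL2P g.
by rewrite -rmorphM /ev_at !evE // rmorphM.
Qed.
HB.instance Definition _ := GRing.isMonoidMorphism.Build kSL2 A (ev_at hx) ev_monoid.
End EvMorphism.

Definition gen_pt : 'M[kSL2]_2 := map_mx kclass gen_mx.

Lemma gen_pt_det : \det gen_pt = 1.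
Proof.
rewrite det_map_mx /=; apply/eqP; rewrite -[X in _ == X](rmorph1 kclass).
by rewrite -Quotient.idealrBE; apply/asboolP; exists 1; rewrite mul1r.
Qed.

Lemma ev_gen_pt (A : comAlgType k) (x : 'M[A]_2) :
  \det x = 1 -> map_mx (ev x) gen_pt = x.
Proof.
move=> hx; rewrite -[RHS]mx_eval_gen; apply/matrixP => i j.
by rewrite !mxE evE.
Qed.

Lemma ev_uniq (A : comAlgType k) (f : {lrmorphism kSL2 -> A}) g :
  f g = ev (map_mx f gen_pt) g.
Proof.
have [p ->] := kSL2P g; rewrite evE; last by rewrite det_map_mx gen_pt_det rmorph1.
by have /= -> := mx_eval_uniq (f \o kclass) p; rewrite map_mx_comp.
Qed.

Lemma ev_morph (A B : comAlgType k) (phi : {lrmorphism A -> B}) (x : 'M[A]_2) f :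
  \det x = 1 -> phi (ev x f) = ev (map_mx phi x) f.
Proof.
move=> hx; have := ev_uniq (phi \o ev_at hx) f; rewrite /= => ->.
by rewrite map_mx_comp /ev_at ev_gen_pt.
Qed.
End CoordinateRing.

(* Subgroup schemes of SL_2 are given by their functors of points on          *)
(* commutative k-algebras: H A g means that the matrix g lies in H(A).        *)
Section GroupSchemes.
Variable k : fieldType.

Definition subfunctor := forall A : comAlgType k, 'M[A]_2 -> Prop.

Definition SL2 : subfunctor := fun A g => \det g = 1.

Definition torus : subfunctor := fun A g => SL2 g /\ is_diag_mx g.

(* the scheme-theoretic normalizer of T: the g with g T_B g^-1 = T_B for all  *)
(* A-algebras B; as \det g = 1, g^-1 is \adj g                                *)
Definition normalizer : subfunctor := fun A g => SL2 g /\
  forall (B : comAlgType k) (phi : {lrmorphism A -> B}) (t : 'M[B]_2),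
    torus t <-> torus (map_mx phi g *m t *m map_mx phi (\adj g)).

(* the kernel of the r-th iterate of the Frobenius map (g_ij) |-> (g_ij ^ p)  *)
Definition frob_ker (p r : nat) : subfunctor := fun A g =>
  SL2 g /\ map_mx (fun x => x ^+ (p ^ r)) g = 1%:M.

End GroupSchemes.

Section RationalModules.
Variable k : fieldType.

(* A rational H-module is a k-space M with A-linear actions of H(A) on        *)
(* M \ox A, functorial in the commutative k-algebra A; values of ract at      *)
(* matrices outside H(A) are irrelevant.                                      *)
Record ratmod (H : subfunctor k) := RatMod {
  rmod_sort :> lmodType k;
  ract : forall A : comAlgType k, 'M[A]_2 -> rmod_sort \ox A -> rmod_sort \ox A;
  ractD : forall (A : comAlgType k) (g : 'M[A]_2),
    H A g -> {morph ract g : x y / x + y};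
  ractZ : forall (A : comAlgType k) (g : 'M[A]_2) (a : A),
    H A g -> {morph ract g : x / ascale a x};
  ract1 : forall (A : comAlgType k) x, ract (1%:M : 'M[A]_2) x = x;
  ractM : forall (A : comAlgType k) (g h : 'M[A]_2) x,
    H A g -> H A h -> ract (g *m h) x = ract g (ract h x);
  ract_nat : forall (A B : comAlgType k) (phi : {lrmorphism A -> B})
      (g : 'M[A]_2) x,
    H A g -> tmap idfun phi (ract g x) = ract (map_mx phi g) (tmap idfun phi x)
}.

Section Defs.
Variable H : subfunctor k.

Definition is_rathom (M N : ratmod H) (f : {linear M -> N}) : Prop :=
  forall (A : comAlgType k) (g : 'M[A]_2), H g ->
  forall x : M \ox A, tmap f idfun (ract g x) = ract g (tmap f idfun x).

(* m lies in M^H *)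
Definition fixed (M : ratmod H) (m : M) : Prop :=
  forall (A : comAlgType k) (g : 'M[A]_2), H g ->
  ract g (m *t (1 : A)) = m *t (1 : A).

Definition rat_injective (I : ratmod H) : Prop :=
  forall (M N : ratmod H) (j : {linear M -> N}) (f : {linear M -> I}),
    is_rathom j -> injective j -> is_rathom f ->
  exists2 h : {linear N -> I}, is_rathom h & forall x, h (j x) = f x.

Record inj_resolution (M : ratmod H) := InjResolution {
  res_obj : nat -> ratmod H;
  res_aug : {linear M -> res_obj 0};
  res_diff : forall n, {linear res_obj n -> res_obj n.+1};
  res_inj : forall n, rat_injective (res_obj n);
  res_aug_hom : is_rathom res_aug;
  res_diff_hom : forall n, is_rathom (res_diff n);
  res_aug_inj : injective res_aug;
  res_exact0 : forall x, res_diff 0 x = 0 <-> exists m, x = res_aug m;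
  res_exactS : forall n x,
    res_diff n.+1 x = 0 <-> exists y, x = res_diff n y
}.

(* H^i(H, M) is the cohomology of the complex of fixed points of an injective *)
(* resolution of M. Vanishing is required for every such resolution; the      *)
(* existence of one is included so that it cannot hold vacuously.             *)
Definition fixed_coboundary (M : ratmod H) (I : inj_resolution M) (i : nat) :
    res_obj I i -> Prop :=
  match i with
  | 0 => fun x => x = 0
  | j.+1 => fun x => exists2 y : res_obj I j, fixed y & x = res_diff I j y
  end.

Definition ratcoh_eq0 (M : ratmod H) (i : nat) : Prop :=
  inhabited (inj_resolution M) /\
  forall (I : inj_resolution M) (x : res_obj I i),
    fixed x -> res_diff I i x = 0 -> fixed_coboundary x.

End Defs.

Definition restrict (H H' : subfunctor k)
    (sHH' : forall (A : comAlgType k) (g : 'M[A]_2), H' A g -> H A g)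
    (M : ratmod H) : ratmod H' :=
  @RatMod H' M (@ract H M)
    (fun A g Hg => ractD (sHH' A g Hg)) (fun A g a Hg => ractZ a (sHH' A g Hg))
    (@ract1 H M) (fun A g h x Hg Hh => ractM x (sHH' A g Hg) (sHH' A h Hh))
    (fun A B phi g x Hg => ract_nat phi x (sHH' A g Hg)).

End RationalModules.

(* Left translation on k[SL_2]: the action of g in SL_2(A) sends f to the     *)
(* function x |-> f (g^-1 x), that is, to the value of f at the point g^-1 x  *)
(* of SL_2(k[SL_2] \ox A), where x is the generic point.                      *)
Section LeftTranslation.
Variable k : fieldType.

Definition ltrans_pt (A : comAlgType k) (g : 'M[A]_2) : 'M[kSL2 k \ox A]_2 :=
  map_mx (@tinr k (kSL2 k) A) (\adj g) *m map_mx (@tinl k (kSL2 k) A) (gen_pt k).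

Definition ltrans (A : comAlgType k) (g : 'M[A]_2) :
    kSL2 k \ox A -> kSL2 k \ox A :=
  tlift (fun f a => ev (ltrans_pt g) f * tinr _ a).

Lemma det_adj (A : comAlgType k) (g : 'M[A]_2) : \det g = 1 -> \det (\adj g) = 1.
Proof.
by move=> hg; have := congr1 determinant (mul_mx_adj g);
   rewrite det_mulmx hg mul1r det1.
Qed.

Lemma adj_mul (A : comAlgType k) (g h : 'M[A]_2) :
  \det g = 1 -> \det h = 1 -> \adj (g *m h) = \adj h *m \adj g.
Proof.
move=> hg hh; have e : g *m h *m (\adj h *m \adj g) = 1%:M.
  by rewrite mulmxA -(mulmxA g) mul_mx_adj hh mulmx1 mul_mx_adj hg.
by rewrite -[LHS]mulmx1 -e mulmxA mul_adj_mx det_mulmx hg hh mulr1 mul1mx.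
Qed.

Lemma ltrans_pt_det (A : comAlgType k) (g : 'M[A]_2) :
  \det g = 1 -> \det (ltrans_pt g) = 1.
Proof.
move=> hg; rewrite det_mulmx (det_map_mx (@tinr k (kSL2 k) A)).
rewrite (det_map_mx (@tinl k (kSL2 k) A)) det_adj // gen_pt_det.
by rewrite !rmorph1 mul1r.
Qed.

Section Hom.
#[local] Opaque ev.
Variables (A : comAlgType k) (g : 'M[A]_2) (hg : \det g = 1).
Let hp := ltrans_pt_det hg.

Lemma ltrans_bilin : bilin (fun f a => ev (ltrans_pt g) f * tinr (kSL2 k) a).
Proof.
split=> [a|f] c x y.
  by rewrite -!/(ev_at hp _) linearP mulrDl -scalerAl.
by rewrite linearP mulrDr -scalerAr.
Qed.

Lemma ltransE f a : ltrans g (f *t a) = ev (ltrans_pt g) f * tinr (kSL2 k) a.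
Proof. by rewrite /ltrans tliftE //; exact: ltrans_bilin. Qed.

Definition ltrans_at of \det g = 1 := ltrans g.

Lemma ltrans_linear : linear (ltrans_at hg).
Proof. exact: tlift_linear ltrans_bilin. Qed.
HB.instance Definition _ := GRing.isLinear.Build k (kSL2 k \ox A) (kSL2 k \ox A)
  *:%R (ltrans_at hg) ltrans_linear.

Lemma ltransD : {morph ltrans g : x y / x + y}.
Proof. exact: tliftD ltrans_bilin. Qed.

Lemma ltrans_monoid : GRing.monoid_morphism (ltrans_at hg).
Proof.
split=> [|x y]; rewrite /ltrans_at.
  by rewrite -[1]/(1 *t 1) ltransE -/(ev_at hp 1) !rmorph1 mulr1.
elim/tensor_ind: x => [u v|x x' h h']; last by rewrite mulrDl !ltransD h h' mulrDl.
elim/tensor_ind: y => [u' v'|y y' h h']; last by rewrite mulrDr !ltransD h h' mulrDr.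
by rewrite pureM !ltransE -!/(ev_at hp _) !rmorphM mulrACA.
Qed.
HB.instance Definition _ := GRing.isMonoidMorphism.Build (kSL2 k \ox A)
  (kSL2 k \ox A) (ltrans_at hg) ltrans_monoid.

Lemma ltrans_tinr a : ltrans g (tinr _ a) = tinr _ a.
Proof. by rewrite ltransE -/(ev_at hp 1) rmorph1 mul1r. Qed.

Lemma ltrans_gen : map_mx (ltrans g) (map_mx (@tinl k _ A) (gen_pt k)) = ltrans_pt g.
Proof.
rewrite -[RHS](ev_gen_pt hp); apply/matrixP => i j.
by rewrite !mxE ltransE rmorph1 mulr1.
Qed.

Lemma ltransZ a : {morph ltrans g : x / ascale a x}.
Proof.
have mulE (x : kSL2 k \ox A) : ascale a x = tinr _ a * x.
  elim/tensor_ind: x => [u v|x y hx hy].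
    by rewrite ascaleE pureM mul1r.
  by rewrite mulrDr -hx -hy /ascale tliftD //; exact: ascale_bilin.
by move=> x; rewrite !mulE -!/(ltrans_at hg _) rmorphM /= /ltrans_at ltrans_tinr.
Qed.
End Hom.

#[local] Opaque ev tlift ltrans.

Lemma kSL2_tensor_ext (A C : comAlgType k) (phi psi : {lrmorphism kSL2 k \ox A -> C}) :
  map_mx phi (map_mx (@tinl k _ A) (gen_pt k))
    = map_mx psi (map_mx (@tinl k _ A) (gen_pt k)) ->
  (forall a : A, phi (tinr _ a) = psi (tinr _ a)) -> phi =1 psi.
Proof.
move=> hX ha; apply: tensor_ext => [x y|x y|f a]; rewrite ?rmorphD //.
have -> : f *t a = @tinl k _ A f * tinr _ a by rewrite pureM mulr1 mul1r.
rewrite !rmorphM; congr (_ * _); last exact: ha.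
pose tl := @tinl k (kSL2 k) A.
have ephi : phi (tl f) = ev (map_mx (phi \o tl) (gen_pt k)) f by apply: (ev_uniq (phi \o tl)).
have epsi : psi (tl f) = ev (map_mx (psi \o tl) (gen_pt k)) f by apply: (ev_uniq (psi \o tl)).
rewrite [LHS]ephi [RHS]epsi; congr (ev _ f).
by rewrite map_mx_comp [RHS]map_mx_comp; exact: hX.
Qed.

Lemma ltrans1 (A : comAlgType k) x : ltrans (1%:M : 'M[A]_2) x = x.
Proof.
have h1 := det1 A 2.
have adj1 : \adj (1%:M : 'M[A]_2) = 1%:M by rewrite -[LHS]mulmx1 mul_adj_mx h1.
apply: (@kSL2_tensor_ext A _ (ltrans_at h1) idfun) => [|a]; last exact: ltrans_tinr.
rewrite [LHS](ltrans_gen h1) [RHS]map_mx_id.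
  by rewrite /ltrans_pt adj1 (map_mx1 (@tinr k (kSL2 k) A)) mul1mx.
by [].
Qed.

Lemma map_ltrans_pt (A C : comAlgType k) (phi : {lrmorphism kSL2 k \ox A -> C})
    (g : 'M[A]_2) :
  map_mx phi (ltrans_pt g) =
    map_mx (phi \o @tinr k _ A) (\adj g) *m map_mx (phi \o @tinl k _ A) (gen_pt k).
Proof. by rewrite (map_mxM phi); congr (_ *m _); rewrite [RHS]map_mx_comp. Qed.

Lemma ltransM (A : comAlgType k) (g h : 'M[A]_2) x :
  \det g = 1 -> \det h = 1 -> ltrans (g *m h) x = ltrans g (ltrans h x).
Proof.
move=> hg hh; have hgh : \det (g *m h) = 1 by rewrite det_mulmx hg hh mulr1.
apply: (@kSL2_tensor_ext A _ (ltrans_at hgh) (ltrans_at hg \o ltrans_at hh)) => [|a].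
  rewrite [LHS](ltrans_gen hgh) [RHS]map_mx_comp.
  rewrite [RHS](congr1 (map_mx (ltrans_at hg)) (ltrans_gen hh)) [RHS]map_ltrans_pt.
  have e1 : map_mx (ltrans_at hg \o @tinr k _ A) (\adj h) = map_mx (@tinr k _ A) (\adj h).
    by apply/matrixP => i j; rewrite !mxE; apply: ltrans_tinr.
  have e2 : map_mx (ltrans_at hg \o @tinl k _ A) (gen_pt k) = ltrans_pt g.
    by rewrite map_mx_comp; exact: (ltrans_gen hg).
  rewrite [RHS](congr2 mulmx e1 e2).
  by rewrite /ltrans_pt adj_mul // (map_mxM (@tinr k _ A)) mulmxA.
rewrite [LHS](ltrans_tinr hgh); apply/esym.
by rewrite -[RHS](ltrans_tinr hg) -[in RHS](ltrans_tinr hh).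
Qed.

Lemma ltrans_nat (A B : comAlgType k) (phi : {lrmorphism A -> B}) (g : 'M[A]_2) x :
  \det g = 1 -> tmap idfun phi (ltrans g x) = ltrans (map_mx phi g) (tmap idfun phi x).
Proof.
move=> hg; have hg' : \det (map_mx phi g) = 1 by rewrite det_map_mx hg rmorph1.
pose tphi : {lrmorphism kSL2 k \ox A -> kSL2 k \ox B} := tmap idfun phi.
have tl f : tphi (tinl A f) = tinl B f by rewrite [LHS]tmapE rmorph1.
have tr a : tphi (tinr _ a) = tinr _ (phi a) by rewrite [LHS]tmapE.
have tgen : map_mx tphi (map_mx (@tinl k _ A) (gen_pt k)) = map_mx (@tinl k _ B) (gen_pt k).
  by apply/matrixP => i j; rewrite !mxE; apply: tl.
apply: (@kSL2_tensor_ext A _ (tphi \o ltrans_at hg) (ltrans_at hg' \o tphi)) => [|a].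
  rewrite [LHS]map_mx_comp [RHS]map_mx_comp tgen.
  rewrite [LHS](congr1 (map_mx tphi) (ltrans_gen hg)).
  rewrite [RHS](ltrans_gen hg') [LHS]map_ltrans_pt; congr (_ *m _).
    by rewrite -map_mx_adj; apply/matrixP => i j; rewrite !mxE; apply: tr.
  by rewrite map_mx_comp.
rewrite -[RHS]/(ltrans (map_mx phi g) (tphi (tinr _ a))) tr [RHS](ltrans_tinr hg').
by rewrite -[LHS]/(tphi (ltrans g (tinr _ a))) (ltrans_tinr hg) tr.
Qed.

Definition kSL2_rat : ratmod (@SL2 k) :=
  @RatMod k (@SL2 k) (kSL2 k) (@ltrans) (@ltransD) (fun A g a hg => ltransZ hg a)
    ltrans1 ltransM ltrans_nat.
End LeftTranslation.

Section FunctionsOnGN.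
Variable k : fieldType.

(* k[G/N]: the f in k[G] with f (x n) = f x for all points x of G and n of N *)
Definition kGN_pred : {pred kSL2 k} := fun f =>
  `[< forall (A : comAlgType k) (x n : 'M[A]_2),
        SL2 x -> normalizer n -> ev (x *m n) f = ev x f >].

Lemma kGN_submod : GRing.submod_closed kGN_pred.
Proof.
have hdet (A : comAlgType k) (x n : 'M[A]_2) :
    SL2 x -> normalizer n -> \det (x *m n) = 1.
  by move=> hx [hn _]; rewrite det_mulmx hx hn mulr1.
split=> [|c f f' /asboolP hf /asboolP hf']; apply/asboolP => A x n hx hn.
  by rewrite -/(ev_at (hdet _ _ _ hx hn) 0) -/(ev_at hx 0) !linear0.
rewrite -/(ev_at (hdet _ _ _ hx hn) _) -/(ev_at hx _) !linearP.
by congr (_ *: _ + _); [exact: hf | exact: hf'].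
Qed.
HB.instance Definition _ := GRing.isSubmodClosed.Build k (kSL2 k) kGN_pred kGN_submod.

Record kGN := KGN { kGN_val :> kSL2 k; _ : kGN_val \in kGN_pred }.
HB.instance Definition _ := [isSub for kGN_val].
HB.instance Definition _ := [Choice of kGN by <:].
HB.instance Definition _ := [SubChoice_isSubLmodule of kGN by <:].

Lemma kGN_val_linear : linear kGN_val.
Proof. by move=> c f f'. Qed.
HB.instance Definition _ :=
  GRing.isLinear.Build k kGN (kSL2 k) *:%R kGN_val kGN_val_linear.

Lemma kGN_retract : {p : {linear kSL2 k -> kGN} | cancel kGN_val p}.
Proof. exact/cid/lin_linv/val_inj. Qed.

#[local] Opaque ev tlift ltrans.

Lemma normalizer_map (A B : comAlgType k) (phi : {lrmorphism A -> B}) (n : 'M[A]_2) :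
  normalizer n -> normalizer (map_mx phi n).
Proof.
move=> [hn hT]; split=> [|C psi t]; first by rewrite /SL2 det_map_mx hn rmorph1.
have e (m : 'M[A]_2) : map_mx (psi \o phi) m = map_mx psi (map_mx phi m).
  exact: map_mx_comp.
have h := hT C (psi \o phi) t; split=> [/h|ht]; last apply/h.
  by rewrite -(map_mx_adj phi) -!e.
by rewrite (e n) (e (\adj n)) (map_mx_adj phi).
Qed.

Section Stable.
Variable A : comAlgType k.

Let incl := tmap kGN_val (@idfun A).
Let proj := tmap (sval kGN_retract) (@idfun A).

Lemma kGN_inclK : cancel incl proj.
Proof.
move=> x; rewrite /incl /proj; elim/tensor_ind: x => [f a|x y hx hy].
  by rewrite !tmapE (svalP kGN_retract).
by rewrite !tmapD hx hy.
Qed.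

Lemma ev_tcontract (C : comAlgType k) (y : 'M[C]_2) (hy : \det y = 1)
    (l : {linear A -> k^o}) (x : kSL2 k \ox A) :
  ev y (tcontract l x) = tcontract l (tmap (ev_at hy) idfun x).
Proof.
rewrite -/(ev_at hy _); elim/tensor_ind: x => [f a|x x' h h'].
  by rewrite tmapE !tcontractE linearZ.
by rewrite !(tcontractD, tmapD) [LHS]linearD; congr (_ + _).
Qed.

Lemma ltrans_stable (g : 'M[A]_2) (f : kGN) (l : {linear A -> k^o}) :
  \det g = 1 -> tcontract l (ev (ltrans_pt g) f) \in kGN_pred.
Proof.
move=> hg; apply/asboolP => C y n hy hn.
have hyn : \det (y *m n) = 1 by rewrite det_mulmx hy hn.1 mulr1.
have E (z : 'M[C]_2) (hz : \det z = 1) :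
    tmap (ev_at hz) idfun (ev (ltrans_pt g) f) =
    ev (map_mx (@tinr k C A) (\adj g) *m map_mx (@tinl k C A) z) f.
  rewrite [LHS](ev_morph (tmap (ev_at hz) (@idfun A))); last exact: ltrans_pt_det.
  congr (ev _ f); rewrite [LHS]map_ltrans_pt; congr (_ *m _).
    by apply/matrixP => i j; rewrite !mxE /= [LHS]tmapE rmorph1.
  rewrite -[in RHS](ev_gen_pt hz).
  by apply/matrixP => i j; rewrite !mxE /= [LHS]tmapE.
rewrite [LHS](ev_tcontract hyn) [RHS](ev_tcontract hy).
rewrite [LHS](congr1 (tcontract l) (E _ hyn)) [RHS](congr1 (tcontract l) (E _ hy)).
congr (tcontract l _).
rewrite (map_mxM (@tinl k C A)) mulmxA.
case: f {E} => f /= /asboolP; apply; last exact: normalizer_map.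
rewrite /SL2 det_mulmx (det_map_mx (@tinr k C A)) (det_map_mx (@tinl k C A)).
by rewrite det_adj // hy !rmorph1 mulr1.
Qed.

Lemma ltrans_kGN (g : 'M[A]_2) (x : kGN \ox A) :
  \det g = 1 -> exists y, ltrans g (incl x) = incl y.
Proof.
move=> hg; elim/tensor_ind: x => [f a|x x' [y hy] [y' hy']]; last first.
  by exists (y + y'); rewrite /incl !tmapD ltransD // -/incl hy hy'.
have [y hy] : exists y, ev (ltrans_pt g) f = incl y.
  exists (proj (ev (ltrans_pt g) f)); apply/eqP; rewrite -subr_eq0; apply/eqP.
  apply: tensor_sep => l.
  have tcE (z : kSL2 k \ox A) :
      tcontract l (incl (proj z)) = kGN_val (sval kGN_retract (tcontract l z)).
    rewrite /incl /proj; elim/tensor_ind: z => [f' a'|z z' h h'].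
      by rewrite !tmapE !tcontractE !linearZ.
    by rewrite !(tcontractD, tmapD) h h' !linearD.
  have tcN (z : kSL2 k \ox A) : tcontract l (- z) = - tcontract l z.
    by rewrite -scaleN1r /tcontract (tliftZ _ _ (tcontract_bilin _ l)) scaleN1r.
  rewrite tcontractD tcN tcE.
  have h := ltrans_stable f l hg.
  by rewrite -[tcontract l _]/(kGN_val (KGN h)) (svalP kGN_retract) subrr.
exists (ascale a y); rewrite /incl tmapE ltransE // hy.
rewrite /incl; elim/tensor_ind: y {hy} => [f' a'|z z' h h'].
  by rewrite ascaleE !tmapE pureM mulr1 mulrC.
by rewrite !(tmapD, mulrDl) h h' -tmapD -(tliftD (ascale_bilin _ a)).
Qed.

(* The action on k[G/N] \ox A restricted from k[G] \ox A (kGN_actE). The       *)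
(* retraction only serves to name the preimage under the injective incl.      *)
Definition kGN_act (g : 'M[A]_2) (x : kGN \ox A) : kGN \ox A :=
  proj (ltrans g (incl x)).

Lemma kGN_actE (g : 'M[A]_2) (x : kGN \ox A) :
  \det g = 1 -> tmap kGN_val idfun (kGN_act g x) = ltrans g (tmap kGN_val idfun x).
Proof.
move=> hg; have [y hy] := ltrans_kGN x hg.
by rewrite /kGN_act -/incl hy kGN_inclK.
Qed.

Lemma kGN_incl_inj : injective (tmap kGN_val (@idfun A)).
Proof. exact: can_inj kGN_inclK. Qed.
End Stable.

Lemma kGN_actD (A : comAlgType k) (g : 'M[A]_2) :
  SL2 g -> {morph kGN_act g : x y / x + y}.
Proof.
by move=> hg x y; rewrite /kGN_act tmapD ltransD // tmapD.
Qed.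

Lemma tmap_ascale (V W : lmodType k) (A : comAlgType k) (f : {linear V -> W}) (a : A) x :
  tmap f idfun (ascale a x) = ascale a (tmap f idfun x).
Proof.
have aD (U : lmodType k) : {morph @ascale k U A a : y z / y + z}.
  exact: tliftD (ascale_bilin _ a).
elim/tensor_ind: x => [v b|x y hx hy]; first by rewrite ascaleE !tmapE ascaleE.
by rewrite aD !tmapD hx hy aD.
Qed.

Lemma kGN_actZ (A : comAlgType k) (g : 'M[A]_2) (a : A) :
  SL2 g -> {morph kGN_act g : x / ascale a x}.
Proof.
by move=> hg x; rewrite /kGN_act tmap_ascale ltransZ // tmap_ascale.
Qed.

Lemma kGN_act1 (A : comAlgType k) x : kGN_act (1%:M : 'M[A]_2) x = x.
Proof. by rewrite /kGN_act ltrans1 kGN_inclK. Qed.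

Lemma kGN_actM (A : comAlgType k) (g h : 'M[A]_2) x :
  SL2 g -> SL2 h -> kGN_act (g *m h) x = kGN_act g (kGN_act h x).
Proof.
move=> hg hh; have hgh : \det (g *m h) = 1 by rewrite det_mulmx hg hh mulr1.
apply: kGN_incl_inj; rewrite [LHS](kGN_actE _ hgh) [RHS](kGN_actE _ hg).
by rewrite [RHS](congr1 (ltrans g) (kGN_actE x hh)) ltransM.
Qed.

Lemma kGN_act_nat (A B : comAlgType k) (phi : {lrmorphism A -> B}) (g : 'M[A]_2) x :
  SL2 g -> tmap idfun phi (kGN_act g x) = kGN_act (map_mx phi g) (tmap idfun phi x).
Proof.
have tmapC (V W : lmodType k) (f : {linear V -> W}) (y : V \ox A) :
    tmap f idfun (tmap idfun phi y) = tmap idfun phi (tmap f idfun y).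
  by elim/tensor_ind: y => [v a|y z hy hz]; rewrite ?tmapE // !tmapD hy hz.
move=> hg; have hg' : \det (map_mx phi g) = 1 by rewrite det_map_mx hg rmorph1.
apply: kGN_incl_inj; rewrite [LHS]tmapC [RHS](kGN_actE _ hg').
rewrite [LHS](congr1 (tmap idfun phi) (kGN_actE x hg)).
by rewrite [RHS](congr1 (ltrans _) (tmapC _ _ _ _)) ltrans_nat.
Qed.

Definition kGN_rat : ratmod (@SL2 k) :=
  @RatMod k (@SL2 k) kGN (@kGN_act) (@kGN_actD) (@kGN_actZ) kGN_act1 kGN_actM
    kGN_act_nat.

End FunctionsOnGN.

Lemma frob_ker_sub (k : fieldType) (p r : nat) (A : comAlgType k) (g : 'M[A]_2) :
  frob_ker p r g -> SL2 g.
Proof. by case. Qed.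

(* Main.v *)
From HB Require Import structures.
Require Import Defs.
From mathcomp Require Import all_boot all_algebra.
From mathcomp Require Import boolp ssrcomplements mpoly ring zify.

(** The ring k[G/N] is itself an injective G_r-module, and an injective module
    has no higher cohomology.

    Write q = 2^r and let a, b, c, d be the matrix entries of SL_2. Injectivity
    rests on a criterion in the style of Higman and Gaschuetz
    ([higman_injective]): given a right-invariant integral on k[G_r] and an
    operator U on a module I whose average, the integral over g of
    g^-1 U g, is the identity of I, every equivariant map M -> I extends along
    every injection M -> N: extend it linearly to theta, and average U theta.

    The integral ([haar]) is explicit. G_r is the product of its lower
    unipotent, diagonal and upper unipotent subgroups, so k[G_r] is
    k[x, t, y] / (x^q, t^q - 1, y^q) ([ldu]), and the functional reading off the
    coefficient of x^(q-1) t^-2 y^(q-1) is right invariant: by the same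
    factorization it suffices to translate by the three kinds of elements
    ([up_invariant], [dg_invariant], [lo_invariant]).

    For U take multiplication by u = (a b c d)^(q-1). In characteristic two,
    a point of N has a zero product in each row ([normalizer_char2]), so both
    a b and c d are invariant under right translation by N
    ([normalizer_row_product]); hence u lies in k[G/N] and U preserves k[G/N].
    Since U is a multiplication and G_r acts by ring automorphisms, the average
    of U is multiplication by the integral over g of x |-> u(g x), and that
    integral is 1 ([haar_abcd]): in characteristic two the coefficient of
    X^(q-1) in (a + b X + c X^2)^(q-1) is b^(q-1) ([middle_coef]), which is used
    once for the variable t^2 x and once for y.

    That injective modules are acyclic for the given notion of cohomology
    ([injective_acyclic]) is the usual contracting homotopy. *)

Set Implicit Arguments.
Unset Strict Implicit.
Unset Printing Implicit Defensive.

Import GRing.Theory.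
Local Open Scope ring_scope.
Local Open Scope quotient_scope.

(** * Rational modules and their equivariant retracts *)

Section Tmap.
Variable k : fieldType.

Lemma tmap_comp (U U' U'' V V' V'' : lmodType k) (f : {linear U -> U'})
    (f' : {linear U' -> U''}) (h : {linear U -> U''})
    (g : {linear V -> V'}) (g' : {linear V' -> V''}) (l : {linear V -> V''}) x :
  (forall u, h u = f' (f u)) -> (forall v, l v = g' (g v)) ->
  tmap f' g' (tmap f g x) = tmap h l x.
Proof.
move=> hh hl; elim/tensor_ind: x => [u v|x y hx hy]; last by rewrite !tmapD hx hy.
by rewrite !tmapE hh hl.
Qed.

Lemma tmap_id (U V : lmodType k) (f : {linear U -> U}) (g : {linear V -> V}) x :
  (forall u, f u = u) -> (forall v, g v = v) -> tmap f g x = x.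
Proof.
move=> hf hg; elim/tensor_ind: x => [u v|x y hx hy]; last by rewrite !tmapD hx hy.
by rewrite !tmapE hf hg.
Qed.

Lemma ascaleD (V : lmodType k) (A : comAlgType k) (a : A) :
  {morph @ascale k V A a : x y / x + y}.
Proof. exact: tliftD (ascale_bilin _ a). Qed.

End Tmap.

Section Retract.
Variables (k : fieldType) (H : subfunctor k) (M : ratmod H) (W : lmodType k).
Variables (inc : {linear W -> M}) (ret : {linear M -> W}).
Hypothesis incK : cancel inc ret.
Hypothesis hom_e : is_rathom (inc \o ret : {linear M -> M}).

(** Since [inc \o ret] is equivariant, the image of [inc] is a submodule, and
    this is the action of that submodule transported to [W]. It gives images
    of idempotents without a general theory of submodules. *)
Definition retract_act (A : comAlgType k) (g : 'M[A]_2) (x : W \ox A) : W \ox A :=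
  tmap ret idfun (ract g (tmap inc idfun x)).

Let e_inc (A : comAlgType k) (x : W \ox A) :
  tmap (inc \o ret : {linear M -> M}) idfun (tmap inc (@idfun A) x) = tmap inc idfun x.
Proof. by apply: tmap_comp => // u /=; rewrite incK. Qed.

Let inc_ret (A : comAlgType k) (x : M \ox A) :
  tmap inc idfun (tmap ret (@idfun A) x) =
  tmap (inc \o ret : {linear M -> M}) idfun x.
Proof. exact: tmap_comp. Qed.

Let ret_inc (A : comAlgType k) (x : W \ox A) :
  tmap ret idfun (tmap inc (@idfun A) x) = x.
Proof. by rewrite (@tmap_comp _ _ _ _ _ _ _ _ _ idfun _ _ idfun) // tmap_id. Qed.

Lemma retract_actE (A : comAlgType k) (g : 'M[A]_2) (x : W \ox A) : H g ->
  tmap inc idfun (retract_act g x) = ract g (tmap inc idfun x).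
Proof. by move=> Hg; rewrite inc_ret hom_e // e_inc. Qed.

Lemma retract_actD (A : comAlgType k) (g : 'M[A]_2) :
  H g -> {morph retract_act g : x y / x + y}.
Proof. by move=> Hg x y; rewrite /retract_act tmapD ractD // tmapD. Qed.

Lemma retract_actZ (A : comAlgType k) (g : 'M[A]_2) (a : A) :
  H g -> {morph retract_act g : x / ascale a x}.
Proof. by move=> Hg x; rewrite /retract_act tmap_ascale ractZ // tmap_ascale. Qed.

Lemma retract_act1 (A : comAlgType k) x : retract_act (1%:M : 'M[A]_2) x = x.
Proof. by rewrite /retract_act ract1 ret_inc. Qed.

Lemma retract_actM (A : comAlgType k) (g h : 'M[A]_2) x :
  H g -> H h -> retract_act (g *m h) x = retract_act g (retract_act h x).
Proof.
by move=> Hg Hh; rewrite [in RHS]/retract_act retract_actE // -ractM.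
Qed.

Lemma retract_act_nat (A B : comAlgType k) (phi : {lrmorphism A -> B})
    (g : 'M[A]_2) x : H g ->
  tmap idfun phi (retract_act g x) = retract_act (map_mx phi g) (tmap idfun phi x).
Proof.
move=> Hg; rewrite /retract_act.
have C (V V' : lmodType k) (f : {linear V -> V'}) (y : V \ox A) :
    tmap idfun phi (tmap f idfun y) = tmap f idfun (tmap idfun phi y).
  by rewrite !(@tmap_comp _ _ _ _ _ _ _ _ _ f _ _ phi).
by rewrite C ract_nat // C.
Qed.

Definition retract_rat : ratmod H :=
  @RatMod k H W retract_act retract_actD retract_actZ retract_act1 retract_actM
    retract_act_nat.

Lemma retract_inc_hom : is_rathom (inc : {linear retract_rat -> M}).
Proof. by move=> A g Hg x; rewrite -retract_actE. Qed.

End Retract.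

(** * Acyclicity of injective modules *)

Section InjectiveAcyclic.
Variables (k : fieldType) (H : subfunctor k).

Lemma rathom_fixed (M N : ratmod H) (f : {linear M -> N}) m :
  is_rathom f -> fixed m -> fixed (f m).
Proof.
move=> hf hm A g Hg; have := hf A g Hg (m *t 1).
by rewrite hm // tmapE.
Qed.

(** The image of an idempotent [e], presented as its fixed points. *)
Section Image.
Variables (V : lmodType k) (e : {linear V -> V}).
Hypothesis eK : forall x, e (e x) = e x.

Definition fix_pred : {pred V} := fun x => e x == x.
Lemma fix_submod : GRing.submod_closed fix_pred.
Proof.
split=> [|c x y]; rewrite !unfold_in ?linear0 //.
by move=> /eqP ex /eqP ey; rewrite linearP ex ey.
Qed.
HB.instance Definition _ := GRing.isSubmodClosed.Build k V fix_pred fix_submod.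

Record fixpts := FixPt { fix_val :> V; _ : fix_val \in fix_pred }.
HB.instance Definition _ := [isSub for fix_val].
HB.instance Definition _ := [Choice of fixpts by <:].
HB.instance Definition _ := [SubChoice_isSubLmodule of fixpts by <:].

Lemma fix_val_linear : linear fix_val. Proof. by []. Qed.
HB.instance Definition _ :=
  GRing.isLinear.Build k fixpts V *:%R fix_val fix_val_linear.

Lemma fix_proj_subproof x : e x \in fix_pred.
Proof. by rewrite unfold_in eK. Qed.
Definition fix_proj x := FixPt (fix_proj_subproof x).
Lemma fix_proj_linear : linear fix_proj.
Proof. by move=> c x y; apply: val_inj; exact: linearP. Qed.
HB.instance Definition _ :=
  GRing.isLinear.Build k V fixpts *:%R fix_proj fix_proj_linear.

Lemma fix_valK : cancel fix_val fix_proj.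
Proof. by case=> x hx; apply: val_inj; apply/eqP. Qed.
End Image.

Lemma rathomB (M : ratmod H) (f : {linear M -> M}) (h : {linear M -> M}) :
  (forall x, h x = x - f x) -> is_rathom f -> is_rathom h.
Proof.
move=> hE hf A g Hg x.
have E (y : M \ox A) : tmap h idfun y = y - tmap f idfun y.
  elim/tensor_ind: y => [m a|y z hy hz]; last by rewrite !tmapD hy hz opprD addrACA.
  by rewrite !tmapE hE pureDl -scaleN1r pureZl scaleN1r.
rewrite !E hf //; apply: (addIr (ract g (tmap f idfun x))).
by rewrite subrK -ractD // subrK.
Qed.

Lemma rathom_comp (M N P : ratmod H) (f : {linear M -> N}) (g : {linear N -> P})
    (h : {linear M -> P}) :
  (forall x, h x = g (f x)) -> is_rathom f -> is_rathom g -> is_rathom h.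
Proof.
move=> hE hf hg A a Ha x.
have E y : tmap h idfun y = tmap g idfun (tmap f (@idfun A) y).
  by apply/esym/tmap_comp.
by rewrite !E hf // hg.
Qed.

(** One step of a contracting homotopy. If [s] satisfies [d s d = d], then
    [e = 1 - d s] is an idempotent with kernel the image of [d], which is the
    kernel of [d']; so [d'] embeds the image of [e] into [N], and the inclusion
    of that image into the injective module [M] extends along this embedding. *)
Lemma split_step (L M N : ratmod H) (d : {linear L -> M}) (d' : {linear M -> N})
    (s : {linear M -> L}) :
  is_rathom d -> is_rathom d' -> is_rathom s ->
  (forall x, d' x = 0 <-> exists y, x = d y) ->
  (forall x, d (s (d x)) = d x) -> rat_injective M ->
  exists2 s' : {linear N -> M}, is_rathom s' & forall x, d' (s' (d' x)) = d' x.
Proof.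
move=> hd hd' hs ex dsd injM.
pose e : {linear M -> M} := idfun \- (d \o s).
have eE x : e x = x - d (s x) by [].
have d'e x : d' (e x) = d' x.
  rewrite eE linearB; have -> : d' (d (s x)) = 0 by apply/ex; exists (s x).
  by rewrite subr0.
have ed y : e (d y) = 0 by rewrite eE dsd subrr.
have eK x : e (e x) = e x by rewrite [e x in LHS]eE linearB ed subr0.
have he : is_rathom e.
  by apply: (rathomB (f := d \o s)) => //; apply: (rathom_comp (f := s) (g := d)).
pose inc : {linear fixpts e -> M} := @fix_val M e.
pose ret : {linear M -> fixpts e} := fix_proj eK.
have he' : is_rathom (inc \o ret : {linear M -> M}).
  move=> A g Hg x.
  have E y : tmap (inc \o ret : {linear M -> M}) (@idfun A) y = tmap e idfun y.
    by elim/tensor_ind: y => [m a|y z hy hz]; rewrite ?tmapE // !tmapD hy hz.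
  by rewrite !E he.
have incK : cancel inc ret by exact: fix_valK.
pose W := retract_rat incK he'.
have hinc : is_rathom (inc : {linear W -> M}) by exact: retract_inc_hom.
pose j : {linear W -> N} := d' \o inc.
have hj : is_rathom j by apply: (rathom_comp (f := (inc : {linear W -> M})) (g := d')).
have j0 w : j w = 0 -> w = 0.
  move=> /ex[y hy]; apply: (can_inj incK); rewrite linear0.
  have <- : e (inc w) = inc w by case: w {hy} => w hw; apply/eqP.
  by rewrite hy ed.
have inj_j : injective j.
  move=> w w' hw; apply/eqP; rewrite -subr_eq0; apply/eqP/j0.
  by rewrite linearB hw subrr.
have [s' hs' s'j] := injM W N j inc hj inj_j hinc.
exists s' => // x.
(* d' e = d' because d' d = 0, so s' inverts d' up to the kernel of d' *)
have := s'j (ret x); rewrite /j /= d'e => ->.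
exact: d'e.
Qed.

(** The augmentation of an injective module splits, and the splitting
    propagates along the resolution by [split_step]. *)
Lemma injective_resolution_split (M : ratmod H) (I : inj_resolution M) n :
  rat_injective M ->
  exists2 s : {linear res_obj I n.+1 -> res_obj I n}, is_rathom s &
    forall x, res_diff I n (s (res_diff I n x)) = res_diff I n x.
Proof.
move=> injM; elim: n => [|n [s hs dsd]]; last first.
  exact: (split_step (@res_diff_hom _ _ _ I n) (@res_diff_hom _ _ _ I n.+1) hs
    (@res_exactS _ _ _ I n) dsd (@res_inj _ _ _ I n.+1)).
have [|s hs sK] := injM M (res_obj I 0) (res_aug I) idfun
  (@res_aug_hom _ _ _ I) (@res_aug_inj _ _ _ I).
  by move=> A g Hg x; rewrite !tmap_id.
apply: (split_step (@res_aug_hom _ _ _ I) (@res_diff_hom _ _ _ I 0) hs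
  (@res_exact0 _ _ _ I) _ (@res_inj _ _ _ I 0)).
by move=> x; rewrite sK.
Qed.

Section ZeroModule.
Let Z : lmodType k := ('rV[k]_0 : lmodType k).

Lemma tensor_rV0 (A : lmodType k) (x : Z \ox A) : x = 0.
Proof.
elim/tensor_ind: x => [v a|x y -> ->]; last by rewrite addr0.
by rewrite (thinmx0 v) pure0l.
Qed.

Definition zero_rat : ratmod H.
Proof.
by apply: (@RatMod k H Z (fun A _ => idfun)) => // *; rewrite !(tensor_rV0 (A := _)).
Defined.
End ZeroModule.

Lemma zero_hom (M N : ratmod H) (f : {linear M -> N}) :
  (forall x, f x = 0) -> is_rathom f.
Proof.
move=> f0 A g Hg x.
have E y : tmap f (@idfun A) y = 0.
  by elim/tensor_ind: y => [m a|y z hy hz]; rewrite ?tmapE ?tmapD ?hy ?hz ?f0 ?addr0 ?pure0l.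
rewrite !E; apply/esym/(addrI (ract g 0)); by rewrite -ractD // !addr0.
Qed.

Lemma zero_injective : rat_injective zero_rat.
Proof.
move=> M N j f hj inj_j hf; exists (\0 : {linear N -> zero_rat}); first exact: zero_hom.
by move=> x; rewrite [RHS]thinmx0 [LHS]thinmx0.
Qed.

(** A fixed cocycle [x] is [d y] for some [y], hence also [d (s x)] by
    [d s d = d], and [s x] is fixed since [s] is equivariant. A resolution
    exists: M -> M -> 0 -> 0 -> ... . *)
Theorem injective_acyclic (M : ratmod H) (i : nat) :
  rat_injective M -> (0 < i)%N -> ratcoh_eq0 M i.
Proof.
move=> injM i_gt0; split; last first.
  case: i i_gt0 => // n _ I x hx dx.
  have [s hs dsd] := injective_resolution_split I n injM.
  have [y xy] := (@res_exactS _ _ _ I n x).1 dx.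
  by exists (s x); [exact: rathom_fixed | rewrite xy dsd].
constructor.
pose obj n := if n is 0 then M else zero_rat.
apply: (@InjResolution k H M obj idfun (fun n => \0)).
- by case=> [|n] //; exact: zero_injective.
- by move=> A g Hg x; rewrite !tmap_id.
- by move=> n; apply: zero_hom.
- by [].
- by move=> x; split=> // _; exists x.
- by move=> n x; split=> // _; exists 0; rewrite [LHS]thinmx0.
Qed.
End InjectiveAcyclic.

(** * Averaging over a group scheme with an invariant integral *)

HB.instance Definition _ (k : fieldType) (V A : lmodType k) (l : {linear A -> k^o}) :=
  GRing.isLinear.Build k (V \ox A) V *:%R (tcontract l)
    (tlift_linear (tcontract_bilin V l)).

Lemma adjK (k : fieldType) (A : comAlgType k) (g : 'M[A]_2) :
  \det g = 1 -> \adj (\adj g) = g.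
Proof.
move=> hg; rewrite -[LHS]mul1mx -[1%:M](_ : g *m \adj g = _); last first.
  by rewrite mul_mx_adj hg.
by rewrite -mulmxA mul_mx_adj det_adj // mulmx1.
Qed.

Section Averaging.
Variables (k : fieldType) (H : subfunctor k).

(** The closure properties of a subgroup scheme of SL_2; the adjugate is the
    inverse. *)
Record group_like : Prop := GroupLike {
  grp_SL2 : forall (A : comAlgType k) (g : 'M[A]_2), H g -> \det g = 1;
  grp_mul : forall (A : comAlgType k) (g h : 'M[A]_2), H g -> H h -> H (g *m h);
  grp_adj : forall (A : comAlgType k) (g : 'M[A]_2), H g -> H (\adj g);
  grp_map : forall (A B : comAlgType k) (phi : {lrmorphism A -> B}) (g : 'M[A]_2),
    H g -> H (map_mx phi g) }.

(** [pt] plays the role of the generic point of the group scheme, [E] of its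
    coordinate ring. The map [tau] is the substitution pt := pt g, and the last
    condition says that the integral [lam], extended A-linearly, is unchanged
    by it. *)
Definition translation_invariant (E : comAlgType k) (pt : 'M[E]_2)
    (lam : {linear E -> k^o}) (A : comAlgType k) (g : 'M[A]_2) : Prop :=
  exists tau : {lrmorphism A \ox E -> A \ox E},
    [/\ forall a, tau (tinl E a) = tinl E a,
        map_mx tau (map_mx (@tinr k A E) pt) =
          map_mx (@tinr k A E) pt *m map_mx (@tinl k A E) g
      & forall w, tcontract lam (tau w) = tcontract lam w].

Hypothesis grpH : group_like.
Variables (E : comAlgType k) (pt : 'M[E]_2) (lam : {linear E -> k^o}).
Hypothesis Hpt : H pt.
Hypothesis lam_inv : forall (A : comAlgType k) (g : 'M[A]_2), H g ->
  translation_invariant pt lam g.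

Lemma ascale_alg (V : lmodType k) (A : comAlgType k) c (x : V \ox A) :
  ascale (c%:A) x = c *: x.
Proof.
elim/tensor_ind: x => [v a|x y hx hy]; last by rewrite ascaleD hx hy scalerDr.
by rewrite ascaleE mulr_algl pureZr.
Qed.

Lemma ract_linear (M : ratmod H) (A : comAlgType k) (g : 'M[A]_2) : H g ->
  linear (@ract k H M A g).
Proof. by move=> Hg c x y; rewrite ractD // -!ascale_alg ractZ. Qed.

Lemma ractZk (M : ratmod H) (A : comAlgType k) (g : 'M[A]_2) c (x : M \ox A) :
  H g -> ract g (c *: x) = c *: ract g x.
Proof. by move=> Hg; rewrite -!ascale_alg ractZ. Qed.

Section Average.
Variables (N I : ratmod H) (theta : {linear N -> I}).

(** h^-1 theta h, for a point h of the group with values in [B]. *)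
Definition conjugate (B : comAlgType k) (h : 'M[B]_2) (x : N \ox B) : I \ox B :=
  ract (\adj h) (tmap theta idfun (ract h x)).

Definition average (n : N) : I :=
  tcontract lam (conjugate pt (n *t 1)).

Lemma average_linear : linear average.
Proof.
move=> c x y; rewrite /average /conjugate pureDl pureZl.
rewrite (ract_linear Hpt) linearP (ract_linear (grp_adj grpH Hpt)).
exact: linearP.
Qed.
HB.instance Definition _ := GRing.isLinear.Build k N I *:%R average average_linear.

(** Over a test algebra [A] the average is an integral of the conjugates of
    theta by the generic point, taken over the algebra B = A \ox E in which the
    generic point and an A-point g can be multiplied ([average_int]). *)
Section Equivariance.
Variables (A : comAlgType k) (g : 'M[A]_2) (Hg : H g).
Let B : comAlgType k := A \ox E.
Let inl : {lrmorphism A -> B} := @tinl k A E.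
Let inr : {lrmorphism E -> B} := @tinr k A E.
Let int (V : lmodType k) : {linear V \ox B -> V \ox A} :=
  tmap idfun (tcontract lam).

Lemma int_pure (V : lmodType k) (v : V) a e :
  int V (v *t (a *t e)) = (lam e : k) *: (v *t a).
Proof. by rewrite [LHS]tmapE -pureZr; congr (_ *t _); exact: tcontractE. Qed.

Lemma int_inl (V : lmodType k) (y : V \ox A) a e :
  int V (ascale (a *t e) (tmap idfun inl y)) = (lam e : k) *: ascale a y.
Proof.
elim/tensor_ind: y => [v b|x y hx hy]; last by rewrite tmapD !ascaleD linearD hx hy scalerDr.
by rewrite tmapE !ascaleE /inl /= /tinl pureM mulr1 int_pure.
Qed.

Lemma int_inr (V : lmodType k) (w : V \ox E) : int V (tmap idfun inr w) = tcontract lam w *t 1.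
Proof.
elim/tensor_ind: w => [v e|x y hx hy]; last by rewrite !(tmapD, linearD) hx hy pureDl.
by rewrite tmapE int_pure tcontractE pureZl.
Qed.

Lemma int_ascale (V : lmodType k) a (w : V \ox B) :
  int V (ascale (inl a) w) = ascale a (int V w).
Proof.
elim/tensor_ind: w => [v b|x y hx hy]; last by rewrite ascaleD !linearD ascaleD hx hy.
elim/tensor_ind: b => [b e|b c hb hc]; last first.
  by rewrite !pureDr ascaleD !linearD ascaleD hb hc.
rewrite ascaleE /inl /= /tinl pureM mul1r !int_pure -!pureZr ascaleE.
by rewrite -scalerAr.
Qed.

Lemma int_ract (w : I \ox B) :
  int I (ract (map_mx inl g) w) = ract g (int I w).
Proof.
have HgB : H (map_mx inl g) by apply: grp_map.
elim/tensor_ind: w => [v b|x y hx hy]; last by rewrite ractD // !linearD ractD // hx hy.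
elim/tensor_ind: b => [a e|b c hb hc]; last first.
  by rewrite !pureDr ractD // !linearD ractD // hb hc.
have -> : v *t (a *t e) = ascale (a *t e) (tmap idfun inl (v *t 1)) :> I \ox B.
  by rewrite tmapE ascaleE /= rmorph1 mulr1.
rewrite ractZ // -ract_nat // !int_inl.
by rewrite ractZk // ractZ.
Qed.

(** This is the only place where invariance of the integral enters. *)
Lemma int_aut (tau : {lrmorphism B -> B}) (V : lmodType k) (w : V \ox B) :
  (forall b, tcontract lam (tau b) = tcontract lam b) ->
  int V (tmap idfun tau w) = int V w.
Proof.
move=> ht; elim/tensor_ind: w => [v b|x y hx hy]; last by rewrite tmapD !linearD hx hy.
by rewrite tmapE [LHS]tmapE [RHS]tmapE; congr (_ *t _); exact: ht.
Qed.

Let ptB : 'M[B]_2 := map_mx inr pt.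

Lemma conjugate_ascale (h : 'M[B]_2) b x : H h ->
  conjugate h (ascale b x) = ascale b (conjugate h x).
Proof. by move=> Hh; rewrite /conjugate ractZ // tmap_ascale ractZ //; apply: grp_adj. Qed.

Lemma conjugateD (h : 'M[B]_2) x y : H h ->
  conjugate h (x + y) = conjugate h x + conjugate h y.
Proof. by move=> Hh; rewrite /conjugate ractD // tmapD ractD //; apply: grp_adj. Qed.

Lemma conjugate_map (phi : {lrmorphism B -> B}) (h : 'M[B]_2) x : H h ->
  tmap idfun phi (conjugate h x) = conjugate (map_mx phi h) (tmap idfun phi x).
Proof.
move=> Hh; rewrite /conjugate ract_nat ?map_mx_adj; last exact: grp_adj.
have C (y : N \ox B) :
    tmap idfun phi (tmap theta idfun y) = tmap theta idfun (tmap idfun phi y).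
  by rewrite !(@tmap_comp _ _ _ _ _ _ _ _ _ theta _ _ phi).
by rewrite C ract_nat.
Qed.

Lemma average_int (x : N \ox A) :
  tmap average idfun x = int I (conjugate ptB (tmap idfun inl x)).
Proof.
have HptB : H ptB by apply: grp_map.
elim/tensor_ind: x => [n a|x y hx hy]; last by rewrite !tmapD conjugateD // linearD hx hy.
have -> : tmap idfun inl (n *t a) = ascale (inl a) (tmap idfun inr (n *t 1)) :> N \ox B.
  by rewrite !tmapE ascaleE rmorph1 mulr1.
rewrite conjugate_ascale // int_ascale.
have -> : conjugate ptB (tmap idfun inr (n *t 1)) =
    tmap idfun inr (conjugate pt (n *t 1)).
  have C (y : N \ox E) :
      tmap idfun inr (tmap theta idfun y) = tmap theta idfun (tmap idfun inr y).
    by rewrite !(@tmap_comp _ _ _ _ _ _ _ _ _ theta _ _ inr).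
  by rewrite /conjugate ract_nat ?map_mx_adj ?C ?ract_nat //; exact: grp_adj.
by rewrite int_inr ascaleE mulr1 tmapE.
Qed.

End Equivariance.

(** g (h^-1 theta h) = (h g^-1)^-1 theta (h g^-1) g, and the substitution
    h := h g^-1 preserves the integral over h. *)
Lemma average_hom : is_rathom average.
Proof.
move=> A g Hg x; rewrite !average_int // -int_ract //.
set inl := @tinl k A E; set inr := @tinr k A E.
have [tau [tau_inl tau_pt tau_lam]] := lam_inv (grp_adj grpH Hg).
(* tau is right translation by g^-1; it turns one integrand into the other *)
rewrite -[LHS](int_aut _ tau_lam); congr (tmap _ _ _).
have HptB : H (map_mx inr pt) by apply: grp_map.
have HgB : H (map_mx inl g) by apply: grp_map.
rewrite conjugate_map // tau_pt.
have -> : tmap idfun tau (tmap idfun inl (ract g x)) = tmap idfun inl (ract g x).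
  by apply: tmap_comp => // a; rewrite /= tau_inl.
rewrite ract_nat //; set y := tmap idfun inl x.
have Hpg : H (map_mx inr pt *m map_mx inl (\adj g)).
  by apply: grp_mul => //; apply: grp_map => //; apply: grp_adj.
rewrite {1}/conjugate -ractM // -mulmxA -(map_mxM inl) mul_adj_mx (grp_SL2 grpH Hg).
rewrite (map_mx1 inl) mulmx1 /conjugate -[RHS]ractM //; last exact: grp_adj.
congr (ract _ _).
rewrite adj_mul ?(grp_SL2 grpH) //; last by apply: grp_map => //; apply: grp_adj.
by congr (_ *m _); rewrite -map_mx_adj adjK ?(grp_SL2 grpH).
Qed.
End Average.

(** An arbitrary linear extension of [f], composed with [U] and averaged, is
    equivariant. On the image of [j] it equals the average of [U] composed with
    [f], because [f] is equivariant, and so it is still [f]. *)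
Theorem higman_injective (I : ratmod H) (U : {linear I -> I}) :
  (forall v : I, tcontract lam (conjugate U pt (v *t 1)) = v) -> rat_injective I.
Proof.
move=> hU M N j f hj inj_j hf.
have [p pj] := lin_linv inj_j.
pose theta : {linear N -> I} := U \o (f \o p).
exists (average theta); first exact: average_hom.
move=> m; rewrite -[RHS]hU /= /average /conjugate; congr (tcontract lam (ract _ _)).
have -> : f m *t 1 = tmap f (@idfun E) (m *t 1) by rewrite tmapE.
rewrite -hf // (@tmap_comp _ _ _ _ _ _ _ _ _ (U \o f : {linear M -> I}) _ _ idfun) //.
have -> : j m *t 1 = tmap j (@idfun E) (m *t 1) by rewrite tmapE.
rewrite -hj // (@tmap_comp _ _ _ _ _ _ _ _ _ (U \o f : {linear M -> I}) _ _ idfun) //.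
by move=> u /=; rewrite pj.
Qed.
End Averaging.

(** * The coordinate ring of the Frobenius kernel and its integral *)

Section FrobKerAlg.
Variables (k : fieldType) (r : nat).
Let q := (2 ^ r)%N.
Let pol := {mpoly k[3]}.
Let ix : 'I_3 := @Ordinal 3 0 isT.
Let it : 'I_3 := @Ordinal 3 1 isT.
Let iy : 'I_3 := @Ordinal 3 2 isT.

Definition ldu_coord (A : nzRingType) (x t y : A) (i : 'I_3) : A := nth 0 [:: x; t; y] i.

Lemma ldu_coord_x (A : nzRingType) (x t y : A) : ldu_coord x t y ix = x.
Proof. by []. Qed.
Lemma ldu_coord_t (A : nzRingType) (x t y : A) : ldu_coord x t y it = t.
Proof. by []. Qed.
Lemma ldu_coord_y (A : nzRingType) (x t y : A) : ldu_coord x t y iy = y.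
Proof. by []. Qed.

Definition pmono (i j l : nat) : pol := 'X_ix ^+ i * 'X_it ^+ j * 'X_iy ^+ l.

(** Over a base of characteristic two, with q = 2^r, these are the equations of
    G_r in the coordinates of the factorization into lower unipotent, diagonal
    and upper unipotent matrices: entries of unipotent factors have vanishing
    q-th power, the diagonal entry is a q-th root of unity. *)
Definition ldu_ideal : {pred pol} := fun p =>
  `[< exists u v w : pol, p = u * 'X_ix ^+ q + v * ('X_it ^+ q - 1) + w * 'X_iy ^+ q >].

Definition ldu_eval (A : comAlgType k) (x t y : A) (p : pol) : A :=
  mmap (GRing.in_alg A) (ldu_coord x t y) p.

Section Eval.
Variables (A : comAlgType k) (x t y : A).
Lemma ldu_eval_linear : linear (ldu_eval x t y).
Proof. by move=> c p p'; rewrite /ldu_eval raddfD /= mmapZ mulr_algl. Qed.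
HB.instance Definition _ :=
  GRing.isLinear.Build k pol A *:%R (ldu_eval x t y) ldu_eval_linear.
Lemma ldu_eval_monoid : GRing.monoid_morphism (ldu_eval x t y).
Proof. by split=> [|p p']; rewrite /ldu_eval ?rmorph1 ?rmorphM. Qed.
HB.instance Definition _ :=
  GRing.isMonoidMorphism.Build pol A (ldu_eval x t y) ldu_eval_monoid.

Lemma ldu_evalX i : ldu_eval x t y 'X_i = ldu_coord x t y i.
Proof. by rewrite /ldu_eval mmapX mmap1U. Qed.

Lemma ldu_eval_ideal p : x ^+ q = 0 -> t ^+ q = 1 -> y ^+ q = 0 ->
  p \in ldu_ideal -> ldu_eval x t y p = 0.
Proof.
move=> hx ht hy /asboolP[u [v [w ->]]].
rewrite !(rmorphD, rmorphM, rmorphXn, rmorphN, rmorph1) /= !ldu_evalX.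
by rewrite ldu_coord_x ldu_coord_t ldu_coord_y hx ht hy subrr !mulr0 !addr0.
Qed.
End Eval.

Lemma ldu_idealr : idealr_closed ldu_ideal.
Proof.
split.
- by apply/asboolP; exists 0, 0, 0; rewrite !mul0r !addr0.
- apply/negP => /(@ldu_eval_ideal k^o 0 1 0).
  have q0 : (0 : k^o) ^+ q = 0 by rewrite expr0n expn_eq0.
  by rewrite q0 expr1n rmorph1 => /(_ erefl erefl erefl)/eqP; rewrite oner_eq0.
- move=> a _ _ /asboolP[u [v [w ->]]] /asboolP[u' [v' [w' ->]]]; apply/asboolP.
  exists (a * u + u'), (a * v + v'), (a * w + w').
  by ring.
Qed.
HB.instance Definition _ := isIdealr.Build pol ldu_ideal ldu_idealr.

Definition ldu := {ideal_quot ldu_ideal}.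
HB.instance Definition _ := GRing.ComNzRing.on ldu.

Definition ldu_class (p : pol) : ldu := \pi_ldu p.

Lemma ldu_class_additive : additive ldu_class.
Proof. by move=> p p'; rewrite /ldu_class !piE. Qed.
HB.instance Definition _ :=
  GRing.isAdditive.Build pol ldu ldu_class ldu_class_additive.
Lemma ldu_class_monoid : GRing.monoid_morphism ldu_class.
Proof. by split=> [|p p']; rewrite /ldu_class !piE. Qed.
HB.instance Definition _ :=
  GRing.isMonoidMorphism.Build pol ldu ldu_class ldu_class_monoid.

Definition ldu_scale (c : k) (f : ldu) : ldu := ldu_class c%:MP * f.
Let lscaleA a b f : ldu_scale a (ldu_scale b f) = ldu_scale (a * b) f.
Proof. by rewrite /ldu_scale mulrA -rmorphM mpolyCM. Qed.
Let lscale1 : left_id 1 ldu_scale.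
Proof. by move=> f; rewrite /ldu_scale rmorph1 mul1r. Qed.
Let lscaleDr : right_distributive ldu_scale +%R.
Proof. by move=> a f g; rewrite /ldu_scale mulrDr. Qed.
Let lscaleDl f : {morph ldu_scale^~ f : a b / a + b}.
Proof. by move=> a b; rewrite /ldu_scale mpolyCD rmorphD mulrDl. Qed.
HB.instance Definition _ :=
  GRing.Zmodule_isLmodule.Build k ldu lscaleA lscale1 lscaleDr lscaleDl.
Let lscaleAl a (f g : ldu) : a *: (f * g) = (a *: f) * g.
Proof. exact: mulrA. Qed.
HB.instance Definition _ := GRing.Lmodule_isLalgebra.Build k ldu lscaleAl.
HB.instance Definition _ := GRing.Lalgebra_isComAlgebra.Build k ldu.

Lemma ldu_class_scalable : scalable ldu_class.
Proof. by move=> c p; rewrite -mul_mpolyC rmorphM. Qed.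
HB.instance Definition _ :=
  GRing.isScalable.Build k pol ldu *:%R ldu_class ldu_class_scalable.

Definition ldu_x : ldu := ldu_class 'X_ix.
Definition ldu_t : ldu := ldu_class 'X_it.
Definition ldu_y : ldu := ldu_class 'X_iy.

Lemma lduP (f : ldu) : exists p, f = ldu_class p.
Proof. by exists (repr f); rewrite [RHS]reprK. Qed.

Lemma ldu_class_eq p p' : p - p' \in ldu_ideal -> ldu_class p = ldu_class p'.
Proof. by move=> h; apply/eqP; rewrite -Quotient.idealrBE. Qed.

Lemma ldu_xq : ldu_x ^+ q = 0.
Proof.
rewrite -rmorphXn -(rmorph0 ldu_class); apply: ldu_class_eq; apply/asboolP.
by exists 1, 0, 0; rewrite !mul0r !addr0 mul1r subr0.
Qed.
Lemma ldu_tq : ldu_t ^+ q = 1.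
Proof.
rewrite -rmorphXn -(rmorph1 ldu_class); apply: ldu_class_eq; apply/asboolP.
by exists 0, 1, 0; rewrite !mul0r addr0 add0r mul1r.
Qed.
Lemma ldu_yq : ldu_y ^+ q = 0.
Proof.
rewrite -rmorphXn -(rmorph0 ldu_class); apply: ldu_class_eq; apply/asboolP.
by exists 0, 0, 1; rewrite !mul0r !add0r mul1r subr0.
Qed.

Lemma pol_mono m : 'X_[m] = pmono (m ix) (m it) (m iy).
Proof.
rewrite mpolyXE_id !big_ord_recl big_ord0 mulr1 mulrA.
by congr (_ * _ * _); rewrite /=; congr ('X__ ^+ m _); apply: val_inj.
Qed.

Lemma pol_linear_ext (W : lmodType k) (f g : {linear pol -> W}) :
  (forall i j l, f (pmono i j l) = g (pmono i j l)) -> f =1 g.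
Proof.
move=> h p; rewrite [p]mpolyE !linear_sum; apply: eq_bigr => m _.
by rewrite !linearZ /= pol_mono h.
Qed.

Lemma ldu_linear_ext (W : lmodType k) (f g : {linear ldu -> W}) :
  (forall i j l, f (ldu_x ^+ i * ldu_t ^+ j * ldu_y ^+ l) =
    g (ldu_x ^+ i * ldu_t ^+ j * ldu_y ^+ l)) ->
  f =1 g.
Proof.
move=> h e; have [p ->] := lduP e.
apply: (pol_linear_ext (f := f \o ldu_class) (g := g \o ldu_class)) => i j l /=.
by rewrite !rmorphM !rmorphXn h.
Qed.

Section UniversalProperty.
Variables (A : comAlgType k) (x t y : A).
Hypotheses (hx : x ^+ q = 0) (ht : t ^+ q = 1) (hy : y ^+ q = 0).
Definition ldu_map of x ^+ q = 0 & t ^+ q = 1 & y ^+ q = 0 := fun (f : ldu) =>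
  ldu_eval x t y (repr f).

Lemma ldu_mapE p : ldu_map hx ht hy (ldu_class p) = ldu_eval x t y p.
Proof.
apply/eqP; rewrite -subr_eq0 -rmorphB /=; apply/eqP/ldu_eval_ideal => //.
have : ldu_class (repr (ldu_class p)) = ldu_class p by exact: reprK.
by move/eqP; rewrite -Quotient.idealrBE.
Qed.
Lemma ldu_map_linear : linear (ldu_map hx ht hy).
Proof.
move=> c f g; have [p ->] := lduP f; have [p' ->] := lduP g.
by rewrite -linearP !ldu_mapE linearP.
Qed.
HB.instance Definition _ := GRing.isLinear.Build k ldu A *:%R
  (ldu_map hx ht hy) ldu_map_linear.
Lemma ldu_map_monoid : GRing.monoid_morphism (ldu_map hx ht hy).
Proof.
split=> [|f g]; first by rewrite -(rmorph1 ldu_class) ldu_mapE rmorph1.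
have [p ->] := lduP f; have [p' ->] := lduP g.
by rewrite -rmorphM !ldu_mapE rmorphM.
Qed.
HB.instance Definition _ := GRing.isMonoidMorphism.Build ldu A
  (ldu_map hx ht hy) ldu_map_monoid.

Lemma ldu_map_x : ldu_map hx ht hy ldu_x = x.
Proof. by rewrite ldu_mapE ldu_evalX ldu_coord_x. Qed.
Lemma ldu_map_t : ldu_map hx ht hy ldu_t = t.
Proof. by rewrite ldu_mapE ldu_evalX ldu_coord_t. Qed.
Lemma ldu_map_y : ldu_map hx ht hy ldu_y = y.
Proof. by rewrite ldu_mapE ldu_evalX ldu_coord_y. Qed.
End UniversalProperty.

(** The exponent of t is only defined modulo q, and the condition on it is
    j = -2 modulo q. The weight t^-2 is what makes the functional invariant
    under right translation by diagonal and by lower unipotent elements. *)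
Definition haar_coef (i j l : nat) : k :=
  [&& i == q.-1, (q %| j.+2)%N & l == q.-1]%:R.

Definition haar_pol (p : pol) : k^o :=
  \sum_(m <- msupp p) p@_m * haar_coef (m ix) (m it) (m iy).

Lemma haar_polE d p : (msize p <= d)%N ->
  haar_pol p = \sum_(m : 'X_{1..3 < d}) p@_m * haar_coef (m ix) (m it) (m iy).
Proof.
move=> le_pd; pose I : subFinType _ := 'X_{1..3 < d}.
rewrite /haar_pol (big_mksub I) ?msupp_uniq //=; first last.
  by move=> m /msize_mdeg_lt /leq_trans; apply.
by rewrite big_rmcond //= => m /memN_msupp_eq0 ->; rewrite mul0r.
Qed.

Lemma haar_pol_linear : linear haar_pol.
Proof.
move=> c p p'; pose d := maxn (msize (c *: p + p')) (maxn (msize p) (msize p')).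
rewrite !(haar_polE (d := d)); try by rewrite /d; lia.
rewrite scaler_sumr -big_split; apply: eq_bigr => m _ /=.
by rewrite mcoeffD mcoeffZ mulrDl -mulrA.
Qed.
HB.instance Definition _ := GRing.isLinear.Build k pol k^o *:%R haar_pol haar_pol_linear.

Lemma haar_pol_mono i j l : haar_pol (pmono i j l) = haar_coef i j l.
Proof.
rewrite /pmono !mpolyXn -!mpolyXD /haar_pol msuppX big_seq1 mcoeffX eqxx mul1r.
by rewrite !mnmDE !mulmnE !mnmE /= !mul0n !mul1n !addn0 !add0n.
Qed.

(** Vanishing on an ideal can be tested on monomial multiples of a
    generator. *)
Lemma haar_pol_mul (p : pol) : (forall i j l, haar_pol (pmono i j l * p) = 0) ->
  forall u, haar_pol (u * p) = 0.
Proof.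
move=> h u; rewrite [u]mpolyE mulr_suml linear_sum big1 // => m _.
by rewrite -scalerAl linearZ /= pol_mono h scaler0.
Qed.

Lemma haar_pol_ideal p : p \in ldu_ideal -> haar_pol p = 0.
Proof.
have q0 : (0 < q)%N by rewrite expn_gt0.
move=> /asboolP[u [v [w ->]]]; rewrite !linearD /=.
rewrite !haar_pol_mul ?addr0 // => i j l.
- have -> : pmono i j l * 'X_iy ^+ q = pmono i j (l + q) by rewrite /pmono exprD; ring.
  by rewrite haar_pol_mono /haar_coef; case: (l + q == q.-1)%N /eqP; rewrite ?andbF //; lia.
- have -> : pmono i j l * ('X_it ^+ q - 1) = pmono i (j + q) l - pmono i j l.
    by rewrite /pmono exprD; ring.
  rewrite linearB /= !haar_pol_mono /haar_coef -!addSn.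
  by rewrite dvdn_addl // subrr.
- have -> : pmono i j l * 'X_ix ^+ q = pmono (i + q) j l by rewrite /pmono exprD; ring.
  by rewrite haar_pol_mono /haar_coef; case: (i + q == q.-1)%N /eqP; rewrite //; lia.
Qed.

Definition haar (f : ldu) : k^o := haar_pol (repr f).
Lemma haarE p : haar (ldu_class p) = haar_pol p.
Proof.
apply/eqP; rewrite -subr_eq0 -linearB /=; apply/eqP/haar_pol_ideal.
have : ldu_class (repr (ldu_class p)) = ldu_class p by exact: reprK.
by move/eqP; rewrite -Quotient.idealrBE.
Qed.
Lemma haar_linear : linear haar.
Proof.
move=> c f g; have [p ->] := lduP f; have [p' ->] := lduP g.
by rewrite -linearP !haarE linearP.
Qed.
HB.instance Definition _ := GRing.isLinear.Build k ldu k^o *:%R haar haar_linear.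

Lemma haar_mono i j l : haar (ldu_x ^+ i * ldu_t ^+ j * ldu_y ^+ l) = haar_coef i j l.
Proof. by rewrite -!rmorphXn -!rmorphM haarE haar_pol_mono. Qed.
End FrobKerAlg.

(** * Two-by-two matrices *)

Section Mx2.
Variable A : comNzRingType.
Definition mx2 (a b c d : A) : 'M[A]_2 :=
  \matrix_(i, j) (if i == 0 then (if j == 0 then a else b) else (if j == 0 then c else d)).

Lemma mx2P (g h : 'M[A]_2) : g 0 0 = h 0 0 -> g 0 1 = h 0 1 -> g 1 0 = h 1 0 ->
  g 1 1 = h 1 1 -> g = h.
Proof.
move=> h00 h01 h10 h11; apply/matrixP => i j.
have ord2 (l : 'I_2) : l = 0 \/ l = 1.
  by case: l => -[|[|//]] hl; [left|right]; apply: val_inj.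
by case: (ord2 i) => ->; case: (ord2 j) => ->.
Qed.

Lemma mx2_eta (g : 'M[A]_2) : g = mx2 (g 0 0) (g 0 1) (g 1 0) (g 1 1).
Proof. by apply: mx2P; rewrite !mxE. Qed.

Lemma mx2_ind (P : 'M[A]_2 -> Prop) :
  (forall a b c d, P (mx2 a b c d)) -> forall g, P g.
Proof. by move=> h g; rewrite [g]mx2_eta. Qed.

Lemma mx2_mul a b c d a' b' c' d' :
  mx2 a b c d *m mx2 a' b' c' d' =
  mx2 (a * a' + b * c') (a * b' + b * d') (c * a' + d * c') (c * b' + d * d').
Proof. by apply: mx2P; rewrite !mxE !big_ord_recl big_ord0 !mxE /= addr0. Qed.

Lemma mx2_1 : 1%:M = mx2 1 0 0 1.
Proof. by apply: mx2P; rewrite !mxE. Qed.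

Lemma mx2_det a b c d : \det (mx2 a b c d) = a * d - b * c.
Proof.
rewrite (expand_det_row _ 0) !big_ord_recl big_ord0 /cofactor !det_mx11 !mxE /=.
by rewrite expr0 expr1 mul1r mulN1r addr0 mulrN.
Qed.

Lemma mx2_adj a b c d : \adj (mx2 a b c d) = mx2 d (- b) (- c) a.
Proof.
apply: mx2P; rewrite !mxE /cofactor !det_mx11 !mxE /= ?addn0 ?expr0 ?expr1 ?expr2 ?expr1n;
rewrite ?mul1r ?mulN1r ?opprK //.
all: by rewrite ?mulrNN ?mul1r.
Qed.
End Mx2.

Lemma map_mx2 (A B : comNzRingType) (f : A -> B) a b c d :
  map_mx f (mx2 a b c d) = mx2 (f a) (f b) (f c) (f d).
Proof. by apply: mx2P; rewrite !mxE. Qed.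

Lemma mx2_inj (A : comNzRingType) (a b c d a' b' c' d' : A) :
  mx2 a b c d = mx2 a' b' c' d' -> [/\ a = a', b = b', c = c' & d = d'].
Proof.
move=> h; split; [move: (congr1 (fun m : 'M_2 => m 0 0) h)
 | move: (congr1 (fun m : 'M_2 => m 0 1) h) | move: (congr1 (fun m : 'M_2 => m 1 0) h)
 | move: (congr1 (fun m : 'M_2 => m 1 1) h)]; by rewrite !mxE.
Qed.

(** * Invariance of the integral under translations *)

(** The map out of a tensor product of algebras given by maps out of its
    factors. *)
Section Copair.
Variables (k : fieldType) (A E C : comAlgType k).
Variables (f : {lrmorphism A -> C}) (g : {lrmorphism E -> C}).

Definition copair : A \ox E -> C := tlift (fun a e => f a * g e).

Lemma copair_bilin : bilin (fun a e => f a * g e).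
Proof.
split=> [e|a] c x y; first by rewrite linearP mulrDl -scalerAl.
by rewrite linearP mulrDr -scalerAr.
Qed.

Lemma copairE a e : copair (a *t e) = f a * g e.
Proof. by rewrite /copair tliftE //; exact: copair_bilin. Qed.

HB.instance Definition _ := GRing.isLinear.Build k (A \ox E) C *:%R copair
  (tlift_linear copair_bilin).

Lemma copairD : {morph copair : x y / x + y}.
Proof. exact: linearD. Qed.

Lemma copair_monoid : GRing.monoid_morphism copair.
Proof.
split=> [|x y]; first by rewrite -[1]/(1 *t 1) copairE !rmorph1 mulr1.
elim/tensor_ind: x => [u v|x x' h h']; last by rewrite mulrDl !copairD h h' mulrDl.
elim/tensor_ind: y => [u' v'|y y' h h']; last by rewrite mulrDr !copairD h h' mulrDr.
by rewrite pureM !copairE !rmorphM mulrACA.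
Qed.
HB.instance Definition _ := GRing.isMonoidMorphism.Build (A \ox E) C copair copair_monoid.
End Copair.

Section Contract.
Variables (k : fieldType) (A E : comAlgType k) (lam : {linear E -> k^o}).

Lemma tcontract_inl a (w : A \ox E) : tcontract lam (tinl E a * w) = a * tcontract lam w.
Proof.
elim/tensor_ind: w => [b e|x y hx hy]; last by rewrite mulrDr !tcontractD hx hy mulrDr.
by rewrite pureM !tcontractE mul1r scalerAr.
Qed.

Lemma tcontract_inr e : tcontract lam (tinr A e) = (lam e)%:A.
Proof. by rewrite tcontractE. Qed.

Lemma translation_invariantM (pt : 'M[E]_2) (g h : 'M[A]_2) :
  translation_invariant pt lam g -> translation_invariant pt lam h ->
  translation_invariant pt lam (g *m h).
Proof.
move=> [tg [tgl tgp tgi]] [th [thl thp thi]]; exists (tg \o th); split=> [a||w] /=.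
- by rewrite thl tgl.
- rewrite map_mx_comp thp (map_mxM tg) tgp (map_mxM (@tinl k A E)) mulmxA; congr (_ *m _).
  by apply/matrixP => i j; rewrite !mxE; exact: tgl.
- by rewrite tgi thi.
Qed.
End Contract.

Lemma tinl_inj (k : fieldType) (A E : comAlgType k) : injective (@tinl k A E).
Proof.
have [||/eqP|l [l1 _]] := @lin_functional k E (fun b => b = 0) 1.
- by [].
- by move=> a x y -> ->; rewrite scaler0 addr0.
- by rewrite oner_eq0.
move=> a b /(congr1 (tcontract l)).
by rewrite /tinl !tcontractE l1 !scale1r.
Qed.

Section HaarPoly.
Variables (k : fieldType) (A : comAlgType k) (r : nat).
Let q := (2 ^ r)%N.
Let E : comAlgType k := ldu k r.
Let B : comAlgType k := A \ox E.
Let inl : {lrmorphism A -> B} := @tinl k A E.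
Let X : B := tinr A (ldu_x k r).
Let T : B := tinr A (ldu_t k r).
Let Y : B := tinr A (ldu_y k r).
Let Lam : B -> A := tcontract (@haar k r).

Lemma haar_coef_alg i j l : (haar_coef k r i j l)%:A =
  [&& i == q.-1, (q %| j.+2)%N & l == q.-1]%:R :> A.
Proof. by rewrite /haar_coef; case: [&& _, _ & _]; rewrite ?scale1r ?scale0r. Qed.

Lemma Lam_mono a i j l : Lam (inl a * (X ^+ i * T ^+ j * Y ^+ l)) =
  a * [&& i == q.-1, (q %| j.+2)%N & l == q.-1]%:R.
Proof.
rewrite /Lam tcontract_inl -haar_coef_alg -haar_mono -tcontract_inr.
by rewrite /= !rmorphM !rmorphXn.
Qed.

Lemma haar_poly i j (p : {poly A}) : Lam (X ^+ i * T ^+ j * (map_poly inl p).[Y]) =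
  if (i == q.-1) && (q %| j.+2)%N then p`_q.-1 else 0.
Proof.
pose f n : B := inl p`_n * Y ^+ n.
have -> : (map_poly inl p).[Y] = \sum_(n < size p) f n.
  rewrite horner_coef size_map_inj_poly ?rmorph0 //; last exact: tinl_inj.
  by apply: eq_bigr => n _; rewrite coef_map.
rewrite mulr_sumr /Lam linear_sum /=.
have E1 (n : 'I_(size p)) : tcontract (@haar k r) (X ^+ i * T ^+ j * f n) =
    p`_n * [&& i == q.-1, (q %| j.+2)%N & val n == q.-1]%:R.
  by rewrite -Lam_mono /Lam /f mulrCA.
rewrite (eq_bigr _ (fun n _ => E1 n)); case: (i == _) => /=; last first.
  by rewrite big1 // => n _; rewrite mulr0.
case: (q %| _)%N => /=; last by rewrite big1 // => n _; rewrite mulr0.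
rewrite (eq_bigr (fun n : 'I_(size p) => if val n == q.-1 then p`_n else 0)); last first.
  by move=> n _; case: (_ == _); rewrite ?mulr1 ?mulr0.
rewrite -big_mkcond /=; have [q_lt|q_ge] := ltnP q.-1 (size p).
  by rewrite (big_pred1 (Ordinal q_lt)) // => n; rewrite -val_eqE.
rewrite (nth_default _ q_ge) big_pred0 // => n.
by apply/negbTE; rewrite neq_ltn (leq_trans (ltn_ord n) q_ge).
Qed.

End HaarPoly.

Definition lo_mx (A : comNzRingType) (x : A) := mx2 1 0 x 1.
Definition dg_mx (A : comNzRingType) (t t' : A) := mx2 t 0 0 t'.
Definition up_mx (A : comNzRingType) (y : A) := mx2 1 y 0 1.
(** The product of a lower unipotent, a diagonal and an upper unipotent matrix
    ([ldu_mxE]); [t'] stands for the inverse of [t]. *)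
Definition ldu_mx (A : comNzRingType) (x t t' y : A) :=
  mx2 t (t * y) (x * t) (x * t * y + t').

Lemma ldu_mxE (A : comNzRingType) (x t t' y : A) :
  lo_mx x *m dg_mx t t' *m up_mx y = ldu_mx x t t' y.
Proof. by rewrite !mx2_mul; congr mx2; ring. Qed.

Lemma ldu_decomposition (A : comNzRingType) (a b c d a' : A) :
  a * a' = 1 -> a * d - b * c = 1 -> mx2 a b c d = ldu_mx (c * a') a a' (a' * b).
Proof.
move=> h hd; congr mx2; [ring: h | ring: h | ].
have -> : d = a' * (a * d) by ring: h.
by rewrite -[a * d](subrK (b * c)) hd; ring: h.
Qed.

Lemma ldu_mx_up (A : comNzRingType) (x t t' y s : A) :
  ldu_mx x t t' y *m up_mx s = ldu_mx x t t' (y + s).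
Proof. by rewrite mx2_mul; congr mx2; ring. Qed.

Lemma ldu_mx_dg (A : comNzRingType) (x t t' y u u' : A) : u * u' = 1 ->
  ldu_mx x t t' y *m dg_mx u u' = ldu_mx x (t * u) (t' * u') (u' ^+ 2 * y).
Proof. by move=> h; rewrite mx2_mul; congr mx2; ring: h. Qed.

(** Moving a lower unipotent factor to the left past an upper unipotent one;
    [w] is the inverse of 1 + s y. *)
Lemma ldu_mx_lo (A : comNzRingType) (x t t' y s w : A) :
  t * t' = 1 -> (1 + s * y) * w = 1 ->
  ldu_mx x t t' y *m lo_mx s =
  ldu_mx (x + t' ^+ 2 * s * w) (t * (1 + s * y)) (t' * w) (y * w).
Proof.
move=> h hw; have {}hw : s * y * w = 1 - w by rewrite -hw; ring.
by rewrite mx2_mul; congr mx2; ring: h hw.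
Qed.

(** The monomial x^i t^j y^l after the substitution of [ldu_mx_lo], expanded in
    powers of x; the exponent [e] stands for q - 1, and raising to it inverts
    [t] and [v]. *)
Lemma lo_expand (R : comNzRingType) (x t s v y : R) (i j l e : nat) :
  (x + (t ^+ e) ^+ 2 * s * v ^+ e) ^+ i * (t * v) ^+ j * (y * v ^+ e) ^+ l =
  \sum_(m < i.+1) x ^+ (i - m) * t ^+ (e * m + e * m + j) *
    (s ^+ m * v ^+ (e * m + e * l + j) * y ^+ l) *+ 'C(i, m).
Proof.
rewrite exprDn !mulr_suml; apply: eq_bigr => m _; rewrite !mulrnAl; congr (_ *+ _).
by rewrite !exprMn -!exprM !exprD; ring.
Qed.

Section FrobKer.
Variables (k : fieldType) (r : nat).
Let q := (2 ^ r)%N.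
Hypothesis char2 : 2%N \in [pchar k].

Let q_gt0 : (0 < q)%N. Proof. by rewrite expn_gt0. Qed.
Let qS : q = q.-1.+1. Proof. by rewrite prednK. Qed.

Lemma char2_alg (A : comAlgType k) : 2%N \in [pchar A].
Proof. by rewrite pchar_lalg. Qed.

Lemma frobeniusD (R : comNzRingType) (x y : R) : 2%N \in [pchar R] ->
  (x + y) ^+ q = x ^+ q + y ^+ q.
Proof.
move=> ch; apply: exprDn_pchar.
by rewrite (eq_pnat _ (pcharf_eq ch)) pnatX pnat_id ?orbT.
Qed.

Lemma frob_kerP (A : comAlgType k) (a b c d : A) :
  frob_ker 2 r (mx2 a b c d) <->
  [/\ a * d - b * c = 1, a ^+ q = 1, b ^+ q = 0, c ^+ q = 0 & d ^+ q = 1].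
Proof.
rewrite /frob_ker /SL2 mx2_det map_mx2 mx2_1; split.
  by move=> [h /mx2_inj[ha hb hc hd]].
by move=> [h ha hb hc hd]; split=> //; rewrite ha hb hc hd.
Qed.

Lemma frob_ker_grp : group_like (@frob_ker k 2 r).
Proof.
split=> [A g []//|A g h|A g|A B phi g].
- elim/mx2_ind: g => a b c d; elim/mx2_ind: h => a' b' c' d'.
  rewrite mx2_mul => /frob_kerP[h0 h1 h2 h3 h4].
  move=> /frob_kerP[h0' h1' h2' h3' h4']; apply/frob_kerP.
  have ch := char2_alg A.
  rewrite !(frobeniusD _ _ ch) !exprMn h1 h2 h3 h4 h1' h2' h3' h4'.
  rewrite !(mul0r, mulr0, mul1r, addr0, add0r); split=> //.
  have hdet := det_mulmx (mx2 a b c d) (mx2 a' b' c' d').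
  by move: hdet; rewrite mx2_mul !mx2_det h0 h0' mulr1.
- elim/mx2_ind: g => a b c d; rewrite mx2_adj => /frob_kerP[h0 h1 h2 h3 h4]; apply/frob_kerP.
  by rewrite mulrNN [d * a]mulrC !(oppr_pchar2 (char2_alg A) b) (oppr_pchar2 _ c) ?char2_alg.
- elim/mx2_ind: g => a b c d; rewrite map_mx2 => /frob_kerP[h0 h1 h2 h3 h4]; apply/frob_kerP.
  by rewrite -!rmorphXn h1 h2 h3 h4 !rmorph0 !rmorph1 -!rmorphM -rmorphB h0 rmorph1.
Qed.

(** The generic point of G_r. *)
Definition ldu_pt : 'M[ldu k r]_2 :=
  ldu_mx (ldu_x k r) (ldu_t k r) (ldu_t k r ^+ q.-1) (ldu_y k r).

Lemma ldu_pt_frob : frob_ker 2 r ldu_pt.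
Proof.
have ch := char2_alg (ldu k r); have tq := ldu_tq k r.
apply/frob_kerP; rewrite (frobeniusD _ _ ch) -exprM mulnC exprM !exprMn.
rewrite ldu_xq ldu_yq ldu_tq expr1n.
rewrite !(mul0r, mulr0, mul1r, addr0, add0r); split=> //.
rewrite -[RHS]tq -/q [in RHS]qS exprS; ring.
Qed.

Section Invariance.
Variable A : comAlgType k.
Let E : comAlgType k := ldu k r.
Let B : comAlgType k := A \ox E.
Let inl : {lrmorphism A -> B} := @tinl k A E.
Let X : B := tinr A (ldu_x k r).
Let T : B := tinr A (ldu_t k r).
Let Y : B := tinr A (ldu_y k r).
Let Lam : B -> A := tcontract (@haar k r).

Lemma tinrX : [/\ X ^+ q = 0, T ^+ q = 1 & Y ^+ q = 0].
Proof.
by rewrite /X /T /Y -!(rmorphXn (@tinr k A E)) /q ldu_xq ldu_yq ldu_tq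
  !(rmorph0 (@tinr k A E)) rmorph1.
Qed.

(** Translation of the generic point by [g] is again a point of G_r, so it is
    given by a substitution of the three coordinates, and invariance has only
    to be checked on monomials. *)
Lemma substitution_invariant (x t y : B) (g : 'M[A]_2) :
  x ^+ q = 0 -> t ^+ q = 1 -> y ^+ q = 0 ->
  ldu_mx x t (t ^+ q.-1) y = ldu_mx X T (T ^+ q.-1) Y *m map_mx inl g ->
  (forall i j l, Lam (x ^+ i * t ^+ j * y ^+ l) =
     if (i == q.-1) && (q %| j.+2)%N then (l == q.-1)%:R else 0) ->
  translation_invariant ldu_pt (@haar k r) g.
Proof.
move=> hx ht hy hg hL; exists (copair inl (ldu_map hx ht hy)); split=> [a||].
- by rewrite [LHS]copairE rmorph1 mulr1.
- have -> : map_mx (@tinr k A E) ldu_pt = ldu_mx X T (T ^+ q.-1) Y.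
    by rewrite map_mx2 !(rmorphD, rmorphM, rmorphXn).
  have hr e : copair inl (ldu_map hx ht hy) (tinr A e) = ldu_map hx ht hy e.
    by rewrite [LHS]copairE rmorph1 mul1r.
  rewrite -hg map_mx2 !(rmorphD, rmorphM, rmorphXn) /= /X /T /Y !hr.
  by rewrite ldu_map_x ldu_map_t ldu_map_y.
- have Lpsi : Lam \o ldu_map hx ht hy =1 Lam \o @tinr k A E.
    apply: ldu_linear_ext => i j l /=.
    rewrite !rmorphM !rmorphXn /= ldu_map_x ldu_map_t ldu_map_y [LHS]hL.
    have := Lam_mono r (1 : A) i j l; rewrite (rmorph1 (@tinl k A E)) !mul1r => hm.
    by rewrite [RHS]hm andbA; case: (_ && _).
  apply: (@tensor_ext _ _ _ _ (fun w => Lam (copair inl (ldu_map hx ht hy) w)) Lam)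
    => [u v|u v|a e].
  + by rewrite /Lam copairD tcontractD.
  + exact: tcontractD.
  + rewrite copairE /Lam tcontract_inl [X in a * X](Lpsi e) /= /Lam tcontract_inr.
    by rewrite tcontractE mulr_algr.
Qed.

(** Here y becomes y + s, and the coefficient of y^(q-1) in (y + s)^l is
    nonzero only for l = q - 1: for l < q - 1 the degree is too small, and
    (y + s)^q = y^q. *)
Lemma up_invariant (s : A) : s ^+ q = 0 -> translation_invariant ldu_pt (@haar k r) (up_mx s).
Proof.
move=> hs; have [xq tq yq] := tinrX.
apply: (@substitution_invariant X T (Y + inl s)) => // [|| i j l].
- by rewrite (frobeniusD _ _ (char2_alg B)) yq -rmorphXn hs rmorph0 addr0.
- by rewrite map_mx2 rmorph0 rmorph1 -ldu_mx_up.
have -> : Y + inl s = (map_poly inl ('X + s%:P)).[Y].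
  by rewrite rmorphD /= map_polyX map_polyC /= hornerD hornerX hornerC.
rewrite -horner_exp -(rmorphXn (map_poly inl)) [LHS]haar_poly; case: (_ && _) => //.
have XsE : 'X + s%:P = 'X - (- s)%:P :> {poly A} by rewrite polyCN opprK.
have [lq|lq|->] := ltngtP l q.-1.
- by rewrite nth_default // XsE size_exp_XsubC.
- have {}lq : (q <= l)%N by rewrite qS.
  have ch : 2%N \in [pchar {poly A}] by rewrite pchar_poly char2_alg.
  rewrite -(subnK lq) exprD (frobeniusD _ _ ch) -rmorphXn hs /= polyC0 addr0.
  by rewrite coefMXn {1}qS ltnSn.
- have := monic_exp q.-1 (monicXsubC (- s)).
  by rewrite -XsE monicE lead_coefE XsE size_exp_XsubC => /eqP.
Qed.

(** Here t becomes t u and y becomes u^-2 y, so x^(q-1) t^-2 y^(q-1) is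
    multiplied by u^(-2 - 2(q-1)) = u^(-2q) = 1. *)
Lemma dg_invariant (u u' : A) : u ^+ q = 1 -> u * u' = 1 ->
  translation_invariant ldu_pt (@haar k r) (dg_mx u u').
Proof.
move=> hu huu; have [xq tq yq] := tinrX.
have hu' : u' ^+ q = 1 by rewrite -[LHS]mul1r -{1}hu -exprMn huu expr1n.
have uE : u' = u ^+ q.-1 by rewrite -[RHS]mul1r -huu mulrAC -exprS -qS hu mul1r.
apply: (@substitution_invariant X (T * inl u) (inl u' ^+ 2 * Y)) => // [||| i j l].
- by rewrite exprMn tq -(rmorphXn inl) hu rmorph1 mulr1.
- by rewrite exprMn yq mulr0.
- rewrite map_mx2 rmorph0 exprMn -(rmorphXn inl) -uE -ldu_mx_dg //.
  by rewrite -(rmorphM inl) huu rmorph1.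
have -> : X ^+ i * (T * inl u) ^+ j * (inl u' ^+ 2 * Y) ^+ l =
    X ^+ i * T ^+ j * (map_poly inl ((u ^+ j * u' ^+ (l.*2)) *: 'X^l)).[Y].
  rewrite map_polyZ map_polyXn hornerZ hornerXn !exprMn (rmorphM inl) !(rmorphXn inl).
  by rewrite -addnn exprD !mulrA.
rewrite [LHS]haar_poly coefZ coefXn [q.-1 == l]eq_sym; case: andP => // -[_ /dvdnP[n jn]].
case: (l =P q.-1) => [->|_]; rewrite ?mulr0 ?mulr1 //.
have u'E : u' ^+ q.-1.*2 = u ^+ 2.
  rewrite -[RHS]mulr1 -[X in _ * X](expr1n _ 2) -hu' -exprM.
  have -> : (q * 2 = q.-1.*2 + 2)%N by rewrite {1}qS; lia.
  by rewrite exprD mulrCA -exprMn huu expr1n mulr1.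
by rewrite u'E -exprD addn2 jn mulnC exprM hu expr1n.
Qed.

(** With j = -2 modulo q the exponent q - 1 times l plus j is congruent to
    q - 2 - l, so for l < q - 1 the polynomial has degree at most q - 2. This is
    where the weight t^-2 in the integral is needed. *)
Lemma lo_coef (s : A) (l j : nat) : s ^+ q = 0 -> (q %| j.+2)%N ->
  ((1 + s *: 'X) ^+ (q.-1 * l + j) * 'X^l : {poly A})`_q.-1 = (l == q.-1)%:R.
Proof.
move=> hs /dvdnP[n jn].
have ch : 2%N \in [pchar {poly A}] by rewrite pchar_poly char2_alg.
rewrite coefMXn; have [lq|lq|->] := ltngtP l q.-1.
- have vq : (1 + s *: 'X : {poly A}) ^+ q = 1.
    by rewrite (frobeniusD _ _ ch) expr1n exprZn hs scale0r addr0.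
  have -> : (q.-1 * l + j = q * (l + n - 1) + (q.-1 - l).-1)%N.
    have: (j.+2 = n * q)%N by []. have: (0 < n)%N by case: n jn.
    move: lq qS; case: q => // q'; nia.
  rewrite exprD exprM vq expr1n mul1r nth_default //.
  apply: leq_trans (size_poly_exp_leq _ _) _.
  have : (size (1 + s *: 'X : {poly A})%R <= 2)%N.
    rewrite (leq_trans (size_polyD _ _)) // geq_max size_poly1 /=.
    by rewrite (leq_trans (size_scale_leq _ _)) // size_polyX.
  by move: (size _) => n'; move: lq; case: q => // q'; nia.
- by [].
- by rewrite subnn -horner_coef0 horner_exp !hornerE ?mulr0 ?addr0 expr1n.
Qed.

(** Here x becomes x + t^-2 s v^-1, t becomes t v and y becomes y v^-1, where
    v = 1 + s y. Only the leading term in x contributes, and it is evaluated by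
    [lo_coef]. *)
Lemma lo_invariant (s : A) : s ^+ q = 0 -> translation_invariant ldu_pt (@haar k r) (lo_mx s).
Proof.
move=> hs; have [xq tq yq] := tinrX.
have chB := char2_alg B.
pose v : B := 1 + inl s * Y; pose w := v ^+ q.-1.
have vq : v ^+ q = 1.
  by rewrite (frobeniusD _ _ chB) expr1n exprMn yq mulr0 addr0.
have vw : v * w = 1 by rewrite -exprS -qS.
have sq : inl s ^+ q = 0 by rewrite -(rmorphXn inl) hs rmorph0.
pose Z : B := (T ^+ q.-1) ^+ 2 * inl s * w.
have Zq : Z ^+ q = 0 by rewrite !exprMn sq mulr0 mul0r.
have TT : T * T ^+ q.-1 = 1 by rewrite -exprS -qS.
apply: (@substitution_invariant (X + Z) (T * v) (Y * w)) => [||||i j l].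
- by rewrite (frobeniusD _ _ chB) xq Zq addr0.
- by rewrite exprMn tq vq mulr1.
- by rewrite exprMn yq mul0r.
- by rewrite map_mx2 rmorph0 rmorph1 exprMn (ldu_mx_lo _ TT vw).
have mono n e (N M : nat) :
  Lam (X ^+ n * T ^+ e * (inl s ^+ M * v ^+ N * Y ^+ l)) =
  if (n == q.-1) && (q %| e.+2)%N
  then s ^+ M * ((1 + s *: 'X) ^+ N * 'X^l : {poly A})`_q.-1 else 0.
  rewrite -coefZ -[RHS]haar_poly /Lam; congr (tcontract _ (_ * _)).
  rewrite map_polyZ hornerZ (rmorphM (map_poly inl)) (rmorphXn (map_poly inl)) /=.
  rewrite map_polyXn hornerM hornerXn horner_exp (rmorphD (map_poly inl)) rmorph1 /=.
  rewrite map_polyZ map_polyX hornerD hornerZ hornerX hornerC.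
  by rewrite (rmorphXn inl) mulrA.
(* for i >= q both sides vanish, as the q-th powers of X and of X + Z do *)
have [lq|iq] := leqP q i.
  have -> : (i == q.-1) = false by apply/eqP; lia.
  rewrite -(subnK lq) exprD (frobeniusD _ _ chB) xq Zq addr0 mulr0 !mul0r.
  exact: linear0.
have E1 := lo_expand X T (inl s) v Y i j l q.-1.
rewrite [X in Lam X]E1 /Lam linear_sum big_ord_recl /= big1 ?addr0 => [|m _].
  rewrite subn0 muln0 !add0n bin0 mulr1n [LHS]mono.
  by case: andP => // -[_ hj]; rewrite mul1r lo_coef.
rewrite linearMn [X in X *+ _](mono (i - m.+1)%N).
case: (i - m.+1 =P q.-1)%N => [him|_]; last by rewrite mul0rn.
by have := ltn_ord m; move: iq him qS; move: (nat_of_ord m) (q.-1) => m' q' *; lia.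
Qed.

(** The upper left entry of a point of G_r is a unit, being a q-th root of
    unity, so the point is a product of points of the three subgroups. *)
Lemma frob_ker_invariant (g : 'M[A]_2) : frob_ker 2 r g ->
  translation_invariant ldu_pt (@haar k r) g.
Proof.
elim/mx2_ind: g => a b c d /frob_kerP[h0 ha hb hc hd].
pose a' := a ^+ q.-1.
have aa' : a * a' = 1 by rewrite -exprS -qS.
have -> : mx2 a b c d = lo_mx (c * a') *m (dg_mx a a' *m up_mx (a' * b)).
  by rewrite mulmxA ldu_mxE; apply: ldu_decomposition.
apply: translation_invariantM; first by apply: lo_invariant; rewrite exprMn hc mul0r.
apply: translation_invariantM; first exact: dg_invariant.
by apply: up_invariant; rewrite exprMn hb mulr0.
Qed.

End Invariance.
End FrobKer.

(** * The integral of (a b c d)^(q-1) *)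

Section MiddleCoefficient.
Variable R : comNzRingType.
Hypothesis ch : 2%N \in [pchar R].

(** Squaring is additive. *)
Lemma coef_sqr_char2 (p : {poly R}) n :
  (p ^+ 2)`_n = if odd n then 0 else p`_n./2 ^+ 2.
Proof.
have ch' : 2%N \in [pchar {poly R}] by rewrite pchar_poly.
elim/poly_ind: p n => [|p c IH] n; first by rewrite expr0n !coef0 expr0n /=; case: odd.
rewrite (exprDn_pchar _ _ (n := 2)); last by rewrite pnatE.
rewrite exprMn coefD coefMXn -rmorphXn /= coefC coefD coefMX coefC IH.
case: n => [|[|n]] /=; rewrite ?addr0 ?add0r // subn2 /= negbK; case: odd => //.
Qed.

(** By induction on r, using the identity F^(2q - 1) = F (F^(q-1))^2. Only even
    powers of X occur in the square, so the odd coefficient of index 2q - 1 sees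
    only the term b X of F. *)
Lemma middle_coef (a b c : R) r :
  ((a%:P + b *: 'X + c *: 'X^2) ^+ (2 ^ r).-1)`_(2 ^ r).-1 = b ^+ (2 ^ r).-1.
Proof.
elim: r => [|r IH]; first by rewrite !expr0 coef1.
set q := (2 ^ r)%N in IH *; have q0 : (0 < q)%N by rewrite expn_gt0.
have -> : (2 ^ r.+1).-1 = (q.-1 * 2).+1 by rewrite expnS -/q; lia.
rewrite exprS exprM [b ^+ _]exprS [b ^+ (_ * _)]exprM -IH.
set G := _ ^+ q.-1.
rewrite !mulrDl !coefD -scalerAl -scalerAl coefCM !coefZ coefXM coefXnM !coef_sqr_char2 /=.
rewrite muln2 odd_double doubleK mulr0 add0r.
have -> : (if (q.-1.*2.+1 < 2)%N then 0 else
    if odd (q.-1.*2.+1 - 2) then 0 else G`_(q.-1.*2.+1 - 2)%N./2 ^+ 2) = 0 :> R.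
  by case: ltnP => // h; rewrite oddB //= odd_double.
by rewrite mulr0 addr0.
Qed.
End MiddleCoefficient.

(** In characteristic two, with ad + bc = 1, the product of the entries of the
    first row of the translate is t^2 S with S = ab + y + cd y^2, and that of
    the second row is x^2 t^2 S + x + t^-2 cd. Their product is quadratic in
    t^2 x, and S is quadratic in y with middle coefficient 1. *)
Lemma abcd_expand (R : comNzRingType) (a b c d x t t' y : R) : 2%N \in [pchar R] ->
  t * t' = 1 -> a * d - b * c = 1 ->
  let S := a * b + y + (c * d) * y ^+ 2 in
  let m := ldu_mx x t t' y *m mx2 a b c d in
  m 0 0 * m 0 1 * m 1 0 * m 1 1 =
  S * (c * d) + S * (t ^+ 2 * x) + S ^+ 2 * (t ^+ 2 * x) ^+ 2.
Proof.
move=> ch ht h S m; rewrite /m mx2_mul !mxE /=.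
have {}h : a * d = 1 - b * c by rewrite (oppr_pchar2 ch) -h subrK.
have two : 2 = 0 :> R by rewrite mulr2n addrr_pchar2.
have -> : (t * a + t * y * c) * (t * b + t * y * d) = t ^+ 2 * S.
  rewrite /S; transitivity (t ^+ 2 * (a * b + (a * d) * y + y * (b * c) + c * d * y ^+ 2)).
    by ring.
  by rewrite h; ring.
have e2 : (x * t * a + (x * t * y + t') * c) * (x * t * b + (x * t * y + t') * d) =
    x ^+ 2 * t ^+ 2 * S + x + t' ^+ 2 * (c * d).
  rewrite /S; transitivity (x ^+ 2 * t ^+ 2 *
       (a * b + y * (a * d) + y * (b * c) + c * d * y ^+ 2)
     + x * (t * t') * (a * d) + x * (t * t') * (b * c) + 2 * (x * y * c * d * (t * t'))
     + t' ^+ 2 * (c * d)).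
    by ring.
  by rewrite two h ht; ring.
rewrite -mulrA e2; transitivity (S * (c * d) * (t * t') ^+ 2 + S * (t ^+ 2 * x) +
  S ^+ 2 * (t ^+ 2 * x) ^+ 2); first by ring.
by rewrite ht expr1n mulr1.
Qed.

Lemma horner_map_quad (R R' : comNzRingType) (f : {rmorphism R -> R'}) (a b c : R) z :
  (map_poly f (a%:P + b *: 'X + c *: 'X^2)).[z] = f a + f b * z + f c * z ^+ 2.
Proof.
rewrite !rmorphD /= !map_polyZ map_polyC map_polyX map_polyXn.
by rewrite !hornerD !hornerZ hornerC hornerX hornerXn.
Qed.

Section FrobeniusIntegral.
Variables (k : fieldType) (r : nat).
Let q := (2 ^ r)%N.
Hypothesis char2 : 2%N \in [pchar k].

Section Moment.
Variable A : comAlgType k.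
Let E : comAlgType k := ldu k r.
Let B : comAlgType k := A \ox E.
Let inl : {rmorphism A -> B} := @tinl k A E.
Let X : B := tinr A (ldu_x k r).
Let T : B := tinr A (ldu_t k r).
Let Y : B := tinr A (ldu_y k r).
Let Lam : B -> A := tcontract (@haar k r).

Let evY : {rmorphism {poly A} -> B} := horner_eval Y \o map_poly inl.

Lemma evYE p : evY p = (map_poly inl p).[Y]. Proof. by []. Qed.

(** The power (t^2 x)^(q-1) has the weight t^(2q-2) = t^-2 picked out by the
    integral. *)
Lemma haar_horner2 (F : {poly {poly A}}) :
  Lam (map_poly evY F).[T ^+ 2 * X] = (F`_q.-1)`_q.-1.
Proof.
have q_gt0 : (0 < q)%N by rewrite expn_gt0.
have le_F : (size (map_poly evY F) <= size F)%N.
  exact: size_poly.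
rewrite (horner_coef_wide _ le_F) /Lam linear_sum /=.
have mono (i : 'I_(size F)) : tcontract (@haar k r) ((map_poly evY F)`_i * (T ^+ 2 * X) ^+ i) =
    if val i == q.-1 then (F`_i)`_q.-1 else 0.
  rewrite coef_map exprMn -exprM mulrC [T ^+ _ * _]mulrC [LHS]haar_poly.
  case: (val i =P q.-1) => //= ->.
  by rewrite (_ : (2 * q.-1).+2 = 2 * q)%N ?dvdn_mull //; lia.
rewrite (eq_bigr _ (fun n _ => mono n)) -big_mkcond /=.
have [q_lt|q_ge] := ltnP q.-1 (size F).
  by rewrite (big_pred1 (Ordinal q_lt)) // => n; rewrite -val_eqE.
rewrite (nth_default _ q_ge) coef0 big_pred0 // => n.
by apply/negbTE; rewrite neq_ltn (leq_trans (ltn_ord n) q_ge).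
Qed.

(** The two variables are eliminated one after the other by [middle_coef]:
    the coefficient of (t^2 x)^(q-1) is S^(q-1), and that of y^(q-1) in it
    is 1. *)
Lemma haar_abcd (x : 'M[A]_2) : \det x = 1 ->
  let m : 'M[B]_2 := map_mx (@tinr k A E) (ldu_pt k r) *m map_mx inl x in
  Lam ((m 0 0 * m 0 1 * m 1 0 * m 1 1) ^+ q.-1) = 1.
Proof.
elim/mx2_ind: x => a b c d; rewrite mx2_det => h m.
have chA : 2%N \in [pchar A] by apply: char2_alg.
have q_gt0 : (0 < q)%N by rewrite expn_gt0.
have Tt : T * T ^+ q.-1 = 1.
  by rewrite -exprS prednK // -(rmorphXn (@tinr k A E)) ldu_tq rmorph1.
have mE : m = ldu_mx X T (T ^+ q.-1) Y *m mx2 (inl a) (inl b) (inl c) (inl d).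
  by rewrite /m !map_mx2 !(rmorphD, rmorphM, rmorphXn).
have hB : inl a * inl d - inl b * inl c = 1 by rewrite -!rmorphM -rmorphB h rmorph1.
rewrite mE (abcd_expand _ _ (char2_alg char2 B) Tt hB).
pose S : {poly A} := (a * b)%:P + 1 *: 'X + (c * d) *: 'X^2.
pose F : {poly {poly A}} := (S * (c * d)%:P)%:P + S *: 'X + S ^+ 2 *: 'X^2.
have SE : inl a * inl b + Y + inl c * inl d * Y ^+ 2 = evY S.
  by rewrite [RHS]horner_map_quad rmorph1 mul1r !rmorphM.
have cdE : inl c * inl d = evY (c * d)%:P.
  by rewrite [RHS]/= map_polyC /horner_eval hornerC; apply: esym; exact: (rmorphM inl).
have FE : (map_poly evY F).[T ^+ 2 * X] =
    evY S * evY (c * d)%:P + evY S * (T ^+ 2 * X) + evY S ^+ 2 * (T ^+ 2 * X) ^+ 2.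
  rewrite horner_map_quad; congr (_ + _ + _ * _); first exact: (rmorphM evY).
  exact: (rmorphXn evY).
rewrite SE cdE -FE.
rewrite -horner_exp -(rmorphXn (map_poly evY)) haar_horner2.
by rewrite middle_coef ?pchar_poly // middle_coef // expr1n.
Qed.
End Moment.
End FrobeniusIntegral.

(** * Invariants of the normalizer in characteristic two *)

#[local] Opaque ev tlift ltrans.

Section NormalizerInvariants.
Variable k : fieldType.
Hypothesis char2 : 2%N \in [pchar k].

(** A point n conjugates diag(t, t^-1) to a matrix whose off-diagonal entries
    are, up to sign, a b and c d times t^-1 - t. It suffices to take for t a
    fourth root of unity in an algebra where t^3 - t is nonzero; the coordinate
    ring of G_2 contains one. *)
Lemma normalizer_char2 (A : comAlgType k) (a b c d : A) :
  normalizer (mx2 a b c d) -> a * b = 0 /\ c * d = 0.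
Proof.
move=> [hn hT]; pose E : comAlgType k := ldu k 2; pose B : comAlgType k := A \ox E.
pose inl : {lrmorphism A -> B} := @tinl k A E.
pose inr : {lrmorphism E -> B} := @tinr k A E.
pose t : B := inr (ldu_t k 2).
have t4 : t ^+ 4 = 1 by rewrite -(rmorphXn inr) (ldu_tq k 2) rmorph1.
have ht : torus (dg_mx t (t ^+ 3)).
  split; first by rewrite /SL2 mx2_det mulr0 subr0 -exprS.
  by apply/is_diag_mxP => -[[|[|//]] ?] [[|[|//]] ?]; rewrite !mxE.
have [_ /is_diag_mxP hd] := (hT B inl (dg_mx t (t ^+ 3))).1 ht.
(* multiplied by e, t^3 - t becomes x^3 y^3 (1 - t^2), and for q = 4 the integral
   is 0 on the first of its two terms and 1 on the second *)
have kill x : inl x * (t ^+ 3 - t) = 0 -> x = 0.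
  pose e : E := ldu_x k 2 ^+ 3 * ldu_t k 2 * ldu_y k 2 ^+ 3.
  move=> /(congr1 (fun z => tcontract (@haar k 2) (z * inr e))).
  have -> : inl x * (t ^+ 3 - t) * inr e =
      inl x * inr (ldu_x k 2 ^+ 3 * ldu_t k 2 ^+ 0 * ldu_y k 2 ^+ 3 -
        ldu_x k 2 ^+ 3 * ldu_t k 2 ^+ 2 * ldu_y k 2 ^+ 3).
    rewrite -mulrA; congr (_ * _).
    rewrite /t -(rmorphXn inr) -(rmorphB inr) -(rmorphM inr); congr (inr _).
    rewrite /e expr0 mulr1 mulrBl; congr (_ - _).
      transitivity (ldu_t k 2 ^+ 4 * (ldu_x k 2 ^+ 3 * ldu_y k 2 ^+ 3));
        last by rewrite (ldu_tq k 2) mul1r.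
      by ring.
    by ring.
  rewrite mul0r tcontract_inl tcontract_inr linearB /= !haar_mono linear0.
  rewrite /haar_coef /= sub0r scaleN1r mulrN1 => /eqP.
  by rewrite oppr_eq0 => /eqP.
have h01 := hd 0 1 isT; have h10 := hd 1 0 isT; move: h01 h10.
rewrite mx2_adj !map_mx2 !mx2_mul !mxE /=.
rewrite !(mulr0, mul0r, addr0, add0r) !(rmorphN inl) => h01 h10.
split; apply: kill.
  by rewrite (rmorphM inl) -[RHS]h01; ring.
by apply: oppr_inj; rewrite (rmorphM inl) oppr0 -[RHS]h10; ring.
Qed.

(** In characteristic two the determinant of n is ad + bc, which is the
    coefficient of a' b', respectively c' d', in the product of the two entries
    of a row; the other coefficients are ab and cd, which vanish. *)
Lemma normalizer_row_product (A : comAlgType k) (a b c d a' b' c' d' : A) :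
  normalizer (mx2 a b c d) ->
  let m := mx2 a' b' c' d' *m mx2 a b c d in
  m 0 0 * m 0 1 = a' * b' /\ m 1 0 * m 1 1 = c' * d'.
Proof.
move=> hn; have [ab cd] := normalizer_char2 hn.
case: hn; rewrite /SL2 mx2_det (oppr_pchar2 (char2_alg char2 A)) => h _.
rewrite /= mx2_mul !mxE /=; split.
  transitivity (a' ^+ 2 * (a * b) + b' ^+ 2 * (c * d) + a' * b' * (a * d + b * c)).
    by ring.
  by rewrite ab cd h; ring.
transitivity (c' ^+ 2 * (a * b) + d' ^+ 2 * (c * d) + c' * d' * (a * d + b * c)).
  by ring.
by rewrite ab cd h; ring.
Qed.
End NormalizerInvariants.

(** * Injectivity of k[G/N] *)

Section Main.
Variables (k : fieldType) (r : nat).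
Hypothesis char2 : 2%N \in [pchar k].
Let q := (2 ^ r)%N.
Let gen := gen_pt k.

Definition abcd : kSL2 k := (gen 0 0 * gen 0 1 * gen 1 0 * gen 1 1) ^+ q.-1.

Lemma ev_abcd (A : comAlgType k) (x : 'M[A]_2) : \det x = 1 ->
  ev x abcd = (x 0 0 * x 0 1 * x 1 0 * x 1 1) ^+ q.-1.
Proof.
move=> hx; rewrite -/(ev_at hx _) rmorphXn !rmorphM.
have E i j : ev_at hx (gen i j) = x i j.
  by have := congr1 (fun m : 'M_2 => m i j) (ev_gen_pt hx); rewrite mxE.
by congr ((_ * _ * _ * _) ^+ _); exact: E.
Qed.

Lemma abcd_kGN : abcd \in @kGN_pred k.
Proof.
apply/asboolP => A x n hx hn.
rewrite !ev_abcd //; last by rewrite det_mulmx hx hn.1 mulr1.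
elim/mx2_ind: x hx => a' b' c' d' _; elim/mx2_ind: n hn => a b c d hn.
have [h1 h2] := normalizer_row_product char2 a' b' c' d' hn.
by rewrite -[X in X ^+ _]mulrA h1 h2 !mxE /= mulrA.
Qed.

Lemma kGN_mul_subproof (f g : kGN k) : kGN_val f * kGN_val g \in @kGN_pred k.
Proof.
apply/asboolP => A x n hx hn.
have hxn : \det (x *m n) = 1 by rewrite det_mulmx hx hn.1 mulr1.
rewrite -/(ev_at hxn _) -/(ev_at hx _) !rmorphM.
have /asboolP hf : kGN_val f \in @kGN_pred k := valP f.
have /asboolP hg : kGN_val g \in @kGN_pred k := valP g.
by congr (_ * _); [exact: hf | exact: hg].
Qed.
Definition kGN_mul (f g : kGN k) : kGN k := KGN (kGN_mul_subproof f g).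

Lemma kGN_mul_linear f : linear (kGN_mul f).
Proof. by move=> c g h; apply: val_inj; rewrite /= mulrDr scalerAr. Qed.
HB.instance Definition _ f :=
  GRing.isLinear.Build k (kGN k) (kGN k) *:%R (kGN_mul f) (kGN_mul_linear f).

Let I := restrict (@frob_ker_sub k 2 r) (kGN_rat k).
Let u : kGN k := KGN abcd_kGN.
Let U : {linear I -> I} := kGN_mul u.
Let pt := ldu_pt k r.

(** Translation is multiplicative, so the conjugate of multiplication by
    [abcd] is multiplication by the translate of [abcd]. *)
Lemma kGN_average (v : I) :
  tcontract (@haar k r) (conjugate U pt (v *t (1 : ldu k r))) = v.
Proof.
have hpt := grp_SL2 (frob_ker_grp r char2) (ldu_pt_frob r char2).
have hpt' := det_adj hpt.
apply: val_inj.
(* everything is computed in k[G] \ox k[G_r], where translation is a ring map *)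
pose E := ldu k r.
have valc (z : kGN k \ox E) :
    kGN_val (tcontract (@haar k r) z) = tcontract (@haar k r) (tmap (@kGN_val k) idfun z).
  elim/tensor_ind: z => [f e|z w hz hw].
    by rewrite tmapE !tcontractE.
  by rewrite tmapD !tcontractD -hz -hw.
have valU (z : kGN k \ox E) :
    tmap (@kGN_val k) idfun (tmap U idfun z) = tinl E abcd * tmap (@kGN_val k) idfun z.
  elim/tensor_ind: z => [f e|z w hz hw].
    by rewrite !tmapE pureM mul1r.
  by rewrite !tmapD mulrDr hz hw.
rewrite -[LHS]/(kGN_val _) valc.
rewrite [X in tcontract _ X](kGN_actE _ hpt') valU.
rewrite [X in ltrans _ (_ * X)](kGN_actE _ hpt) tmapE.
rewrite -/(ltrans_at hpt' _) rmorphM /= /ltrans_at.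
rewrite -ltransM // mul_adj_mx hpt ltrans1.
rewrite mulrC tcontract_inl -[RHS]mulr1; congr (_ * _).
rewrite /tinl ltransE // rmorph1 mulr1 ev_abcd; last exact: ltrans_pt_det.
rewrite /ltrans_pt (adjK hpt).
exact: (haar_abcd r char2 (gen_pt_det k)).
Qed.

End Main.

Theorem mainTheorem3 (k : fieldType) (char2 : 2%N \in [pchar k]%R) (r i : nat) :
  (1 <= r)%N -> (0 < i)%N ->
  ratcoh_eq0 (restrict (@frob_ker_sub k 2 r) (kGN_rat k)) i.
Proof.
move=> _; apply: injective_acyclic.
exact: (higman_injective (frob_ker_grp r char2) (ldu_pt_frob r char2)
  (@frob_ker_invariant k r char2) (kGN_average char2)).
Qed.
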